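(* Suppose the following four conditions hold for a sequence of neighborhood radii $\{r_n\}_{n\in\mathbb{N}}\subseteq\mathbb{R}_+$ (the same sequence in (ii)–(iv)). (i) (Regularity) (a) $\psi$ and $\nu$ have bounded ranges, uniformly in $n$. (b) There exist constants $L,q>0$ such that $\mathbf{E}[(f_{k,l}(Z_i; g) - f_{k,l}(Z_i; g'))^2] \leq L\, \|g-g'\|_{2,i}^q$ for all $f\in\{\psi,\nu\}$, $k,l\in[p]$, $g,g'\in\mathcal{G}$, $i\in[n]$, $n\in\mathbb{N}$. (ii) (Neighborhood stability) For all $f\in\{\psi,\nu\}$ and $k,l\in[p]$, $$\max_{i,j\in[n]} \mathbf{E}\big[(f_{k,l}(Z_i,\hat g)-f_{k,l}(Z_i,\hat g^{(-i,-j)}))^2\big]^{1/2}\ \vee\ \max_{i,j\in[n]} \mathbf{E}\big[(f_{k,l}(Z_i^*,\hat g)-f_{k,l}(Z_i^*,\hat g^{(-i,-j)}))^2\big]^{1/2} = o(n^{-1/2}).$$ (iii) (Learner consistency) With $q$ from (i), $\max_{i\in[n]}\mathbf{E}\big[\|\hat g^{(-i)}-g_0\|_{2,i}^q\big] = o\big(\bar N_n(r_n)^{-1}\big)$. (iv) (Weak dependence) $n\,\beta_n(r_n)=o(1)$. Then for every $f\in\{\psi,\nu\}$ and all $k,l\in[p]$, $$\Big|\frac1n\sum_{i=1}^n\Big(\big(f_{k,l}(Z_i,\hat g)-f_{k,l}(Z_i,g_0)\big)-\big(F_{k,l}(i,\hat g)-F_{k,l}(i,g_0)\big)\Big)\Big|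 = o_p(n^{-1/2})\quad\text{as } n\to\infty.$$
   Context: For each $n$, observations are indexed by $[n]=\{1,\dots,n\}$ and $\rho_n:[n]\times[n]\to\mathbb{R}_+$ is a semi-metric. For $S_1,S_2\subseteq[n]$, $\rho_n(S_1,S_2)=\min\{\rho_n(i,j): i\in S_1,j\in S_2\}$. For $r\geq 0$, $\mathcal{N}(i,r)=\{j\in[n]:\rho_n(i,j)\le r\}$, and $\bar N_n(r)=n^{-1}\sum_{i=1}^n|\mathcal{N}(i,r)|$. The data is a triangular array $\mathbf{Z}=\{Z_i\}_{i=1}^n$ with $Z_i\in\mathcal{Z}\subseteq\mathbb{R}^{d_z}$. $\mathcal{G}$ is a set of functions $g:\mathcal{Z}\to\mathbb{R}^{d_g}$ containing $g_0$. $\psi:\mathcal{Z}\times\mathcal{G}\to\mathbb{R}^{p\times p}$, $\nu:\mathcal{Z}\times\mathcal{G}\to\mathbb{R}^p$. For $f\in\{\psi,\nu\}$, $f_{k,l}$ denotes the $(k,l)$ entry, with the convention $\nu_{k,l}=\nu_k$ if $k=l$ and $\nu_{k,l}=0$ if $k\ne l$. For a (possibly data-dependent) $g\in\mathcal{G}$, $F_{k,l}(i,g)=\int f_{k,l}(z,g)\,dP_{Z_i}(z)$ (expectation over $Z_i$ with $g$ held fixed), and $\|g\|_{2,i}=\big(\int\|g(z)\|^2dP_{Z_i}(z)\big)^{1/2}$ (Euclidean norm, $g$ held fixed). The machine learner is a measurable map $\mathcal{Z}^n\to\mathcal{G}$; $\hat g$ denotes its output on $\mathbf{Z}$. Let $\tilde{\mathbf{Z}}=\{\tilde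 Z_i\}$ and $\mathbf{Z}^*=\{Z_i^*\}$ be copies of $\mathbf{Z}$ (same joint distribution), with $\mathbf{Z},\tilde{\mathbf{Z}},\mathbf{Z}^*$ mutually independent. For $i,j\in[n]$, $\hat g^{(-i,-j)}$ is the learner's output on the dataset obtained from $\mathbf{Z}$ by replacing $Z_k$ with $\tilde Z_k$ for every $k\in\mathcal{N}(i,r_n)\cup\mathcal{N}(j,r_n)$; $\hat g^{(-i)}:=\hat g^{(-i,-i)}$. For $\sigma$-fields $\mathcal{A},\mathcal{B}$, $\beta(\mathcal{A},\mathcal{B})=\sup\frac12\sum_{j=1}^J\sum_{k=1}^K|\mathbf{P}(A_j\cap B_k)-\mathbf{P}(A_j)\mathbf{P}(B_k)|$, supremum over all finite partitions $\{A_j\}\subseteq\mathcal{A}$, $\{B_k\}\subseteq\mathcal{B}$ of the sample space. With $\sigma(S)=\sigma(\{Z_i\}_{i\in S})$, $\beta_n(r)=\sup\{\beta(\sigma(S_1),\sigma(S_2)): S_1,S_2\subseteq[n], |S_1|=1, \rho_n(S_1,S_2)>r\}$. $a\vee b=\max\{a,b\}$. *)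

(* Defs.v *)
From HB Require Import structures.
From mathcomp Require Import all_boot all_order all_algebra.
From mathcomp Require Import all_classical all_reals all_analysis.
Set Implicit Arguments. Unset Strict Implicit. Unset Printing Implicit Defensive.
Import Order.TTheory GRing.Theory Num.Theory.
Import numFieldNormedType.Exports.
Local Open Scope classical_set_scope.
Local Open Scope ring_scope.

Inductive fsel := Fpsi | Fnu.

Definition fkl (R : ringType) (p : nat) (X G : Type)
  (psi : X -> G -> 'M[R]_p) (nu : X -> G -> 'cV[R]_p)
  (s : fsel) (k l : 'I_p) (z : X) (g : G) : R :=
  match s with
  | Fpsi => psi z g k l
  | Fnu => if k == l then nu z g k 0 else 0
  end.

Definition sqnorm (R : ringType) (m : nat) (v : 'rV[R]_m) : R :=
  \sum_(c < m) v 0 c ^+ 2.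

Definition Ex (R : realType) d (T : measurableType d) (P : probability T R)
  (X : T -> R) : \bar R := (\int[P]_w (X w)%:E)%E.

Definition Fexp (R : realType) d (T : measurableType d) (P : probability T R)
  (X : Type) (Zi : T -> X) (G : Type) (f : X -> G -> R) (g : G) : R :=
  fine (Ex P (fun w => f (Zi w) g)).

Definition norm2i (R : realType) d (T : measurableType d) (P : probability T R)
  (X : Type) (Zi : T -> X) (m : nat) (g : X -> 'rV[R]_m) : \bar R :=
  ((Ex P (fun w => sqnorm (g (Zi w)))) `^ (2^-1))%E.

Definition nbhd (R : realType) (n : nat) (rho : 'I_n -> 'I_n -> R)
  (i : 'I_n) (r : R) : {set 'I_n} := [set j | rho i j <= r].

Definition Nbar (R : realType) (n : nat) (rho : 'I_n -> 'I_n -> R) (r : R) : R :=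
  n%:R^-1 * \sum_(i < n) (#|nbhd rho i r|)%:R.

Definition sigmaS (T : Type) d (XM : measurableType d) (n : nat)
  (Z : 'I_n -> T -> XM) (S : {set 'I_n}) : set (set T) :=
  <<s \bigcup_(i in [set i | i \in S]) preimage_set_system setT (Z i) measurable >>.

Definition fin_partition (T : Type) (A : set (set T)) (J : nat)
  (F : 'I_J -> set T) : Prop :=
  (forall j, A (F j)) /\
  (forall j j', j != j' -> F j `&` F j' = set0) /\
  \big[setU/set0]_(j < J) F j = setT.

Definition beta_coef (R : realType) d (T : measurableType d) (P : probability T R)
  (A B : set (set T)) : \bar R :=
  ereal_sup [set x : \bar R | exists (J K : nat) (F : 'I_J -> set T)
      (H : 'I_K -> set T), fin_partition A F /\ fin_partition B H /\
      x = ((2^-1)%:E * \sum_(j < J) \sum_(k < K)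
             `| P (F j `&` H k) - P (F j) * P (H k) |)%E].

Definition beta_n (R : realType) d (T : measurableType d) (P : probability T R)
  dX (XM : measurableType dX) (n : nat) (Z : 'I_n -> T -> XM)
  (rho : 'I_n -> 'I_n -> R) (r : R) : \bar R :=
  ereal_sup [set x : \bar R | exists (S1 S2 : {set 'I_n}),
      #|S1| = 1%N /\
      (forall i j, i \in S1 -> j \in S2 -> r < rho i j) /\
      x = beta_coef P (sigmaS Z S1) (sigmaS Z S2)].

Definition dataset (T X : Type) (n : nat) (Z : 'I_n -> T -> X) (w : T) : n.-tuple X :=
  [tuple Z i w | i < n].

Definition dataset_repl (R : realType) (T X : Type) (n : nat)
  (Z Zt : 'I_n -> T -> X) (rho : 'I_n -> 'I_n -> R) (r : R) (i j : 'I_n)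
  (w : T) : n.-tuple X :=
  [tuple if (k \in nbhd rho i r) || (k \in nbhd rho j r) then Zt k w else Z k w
   | k < n].

Definition same_law d (T : measurableType d) (R : realType) (P : probability T R)
  dX (X : measurableType dX) (n : nat) (D D' : T -> n.-tuple X) : Prop :=
  forall A : set (n.-tuple X), measurable A -> P (D @^-1` A) = P (D' @^-1` A).

Definition indep3 d (T : measurableType d) (R : realType) (P : probability T R)
  (A B C : set (set T)) : Prop :=
  forall a b c, A a -> B b -> C c ->
    P (a `&` b `&` c) = (P a * P b * P c)%E.

(* Main.v *)
(** Write [D_i] for the i-th summand, [D_i^{-i}] and [D_i^{-i,-j}] for the same
    summand with the learner trained on the data where the neighborhood of [i],
    resp. of [i] and [j], has been resampled.  Stability makes the replacement of
    [D_i] by [D_i^{-i}] cost [o(1)] in the L2 norm of [n^{-1/2} \sum_i D_i].  It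
    remains to bound [n^{-1} \sum_{i,j} E(D_i^{-i} D_j^{-j})].

    If [j] is not a neighbor of [i], then
      [E ((D_i^{-i} - D_i^{-i,-j}) (D_j^{-j} - D_j^{-i,-j}))]
    is [o(1/n)] by stability.  This differs from [E (D_i^{-i} D_j^{-j})] by three
    products in which the data near one index, say [j], enter only through [Z_j],
    in one factor that has mean zero when [Z_j] is integrated against its own law;
    by the definition of the beta coefficient these products are [O(beta_n)].  For
    neighbors, [E (D_i^{-i})^2] is at most the consistency error plus [O(beta_n)],
    and there are [n Nbar] such pairs.

    Passing from beta coefficients to expectations of bounded functions uses that a
    measurable set of a product space is approximated by finite unions of
    rectangles, and that a function with values in [0, 1] is a uniform limit of
    averages of indicators of its superlevel sets. *)

Require Import Defs.
From HB Require Import structures.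
From mathcomp Require Import all_boot all_order all_algebra.
From mathcomp Require Import all_classical all_reals all_analysis.
From mathcomp Require Import measurable_realfun lra ring.
Import Order.TTheory GRing.Theory Num.Theory.
Import numFieldNormedType.Exports.
Local Open Scope classical_set_scope.
Local Open Scope ring_scope.

Set Implicit Arguments. Unset Strict Implicit. Unset Printing Implicit Defensive.

(** * Approximation by finite unions of rectangles *)

(** A measurable map to a finite type stands for a finite measurable partition with labelled,
    possibly empty cells; pairing two maps gives the common refinement. *)
Definition classifier {d} {S : measurableType d} {J : finType} (a : S -> J) :=
  forall j, measurable (a @^-1` [set j]).

Lemma classifier_pair d (S : measurableType d) (J J' : finType) (a : S -> J)
  (a' : S -> J') : classifier a -> classifier a' ->
  classifier (fun x => (a x, a' x)).
Proof.
move=> ma ma' [j j']; rewrite (_ : _ @^-1` _ = a @^-1` [set j] `&` a' @^-1` [set j']).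
  exact: measurableI.
by apply/seteqP; split => x /= => [[-> ->]|[-> ->]].
Qed.

Lemma classifier_bool d (S : measurableType d) (A : set S) :
  measurable A -> classifier (fun x => x \in A).
Proof.
move=> mA [].
  rewrite (_ : _ @^-1` _ = A) //; apply/seteqP; split => x /=.
    by move=> /set_mem.
  by move=> Ax; rewrite mem_set.
rewrite (_ : _ @^-1` _ = ~` A); first exact: measurableC.
apply/seteqP; split => x /=.
  by move=> xA /mem_set; rewrite xA.
by move=> Ax; apply/negbTE/negP => /set_mem.
Qed.

Lemma classifier_comp d d' (S : measurableType d) (S' : measurableType d')
  (J : finType) (f : S -> S') (a : S' -> J) :
  measurable_fun setT f -> classifier a -> classifier (a \o f).
Proof. by move=> mf ma j; rewrite comp_preimage -[_ @^-1` _]setTI; exact: mf. Qed.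

Lemma measurable_classifier d (S : measurableType d) (J : finType) (a : S -> J)
  (s : seq J) : classifier a -> measurable [set x | a x \in s].
Proof.
move=> ma; elim: s => [|j s IH].
  by rewrite (_ : mkset _ = set0)//; apply/seteqP; split.
rewrite (_ : mkset _ = a @^-1` [set j] `|` [set x | a x \in s]); first exact: measurableU.
apply/seteqP; split => x /=; rewrite inE.
  by move=> /orP[/eqP|]; [left|right].
by move=> [->|->]; rewrite ?eqxx ?orbT.
Qed.

(** Finite additivity over the disjoint cells, by induction on a duplicate-free list of labels. *)
Lemma fine_measure_classifier d (S : measurableType d) (R : realType)
  (mu : {finite_measure set S -> \bar R}) (J : finType) (a : S -> J) (T : pred J) :
  classifier a ->
  fine (mu [set x | T (a x)]) = \sum_(j | T j) fine (mu (a @^-1` [set j])).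
Proof.
move=> ma.
have H (s : seq J) : uniq s ->
    fine (mu [set x | a x \in s]) = \sum_(j <- s) fine (mu (a @^-1` [set j])).
  elim: s => [|j s IH] /=.
    rewrite (_ : mkset _ = set0) ?measure0 ?big_nil//.
    by apply/seteqP; split.
  move=> /andP[js us]; rewrite big_cons -IH//.
  rewrite (_ : mkset _ = a @^-1` [set j] `|` [set x | a x \in s]); last first.
    apply/seteqP; split => x /=; rewrite inE.
      by move=> /orP[/eqP|]; [left|right].
    by move=> [->|->]; rewrite ?eqxx ?orbT.
  have ms := measurable_classifier s ma.
  rewrite measureU ?fineD ?fin_num_measure//; apply/seteqP; split => x //= [->].
  by rewrite (negbTE js).
have := H (enum T) (enum_uniq _).
rewrite big_enum/= => <-.
by congr (fine (mu _)); apply/seteqP; split => x /=; rewrite mem_enum.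
Qed.

Section grid_approximation.
Context d1 d2 (S1 : measurableType d1) (S2 : measurableType d2) (R : realType).

(* Finite unions of rectangles. Encoding them by classifiers of the two factors
   and a boolean table makes complements and unions immediate and gives the
   finite partitions that define the beta coefficients. *)
Definition grid (A : set (S1 * S2)) :=
  exists (J K : finType) (a : S1 -> J) (c : S2 -> K) (T : J -> K -> bool),
    [/\ classifier a, classifier c & A = [set z | T (a z.1) (c z.2)]].

Lemma gridC A : grid A -> grid (~` A).
Proof.
move=> [J [K [a [c [T [ma mc ->]]]]]]; exists J, K, a, c, (fun j k => ~~ T j k).
by split => //; apply/seteqP; split => x /= => /negP.
Qed.

Lemma gridU A B : grid A -> grid B -> grid (A `|` B).
Proof.
move=> [J [K [a [c [T [ma mc ->]]]]]] [J' [K' [a' [c' [T' [ma' mc' ->]]]]]].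
exists (J * J')%type, (K * K')%type, (fun x => (a x, a' x)), (fun x => (c x, c' x)),
  (fun j k => T j.1 k.1 || T' j.2 k.2).
split; [exact: classifier_pair|exact: classifier_pair|].
by apply/seteqP; split => x /= /orP.
Qed.

Lemma gridX A B : measurable A -> measurable B -> grid (A `*` B).
Proof.
move=> mA mB; exists bool, bool, (fun x => x \in A), (fun x => x \in B), andb.
split; [exact: classifier_bool|exact: classifier_bool|].
apply/seteqP; split => x /=.
  by move=> [? ?]; rewrite !mem_set.
by move=> /andP[/set_mem ? /set_mem].
Qed.

Lemma grid_measurable A : grid A -> measurable A.
Proof.
move=> [J [K [a [c [T [ma mc ->]]]]]].
have m : classifier (fun z : (S1 * S2)%type => (a z.1, c z.2)).
  by apply: classifier_pair; exact: classifier_comp.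
have := measurable_classifier (enum (fun p : (J * K)%type => T p.1 p.2)) m.
by congr measurable; apply/seteqP; split => x /=; rewrite mem_enum.
Qed.

(** The sets that admit such approximations form a sigma-algebra containing the measurable
    rectangles, and these generate the product sigma-algebra. *)
Lemma grid_approx (mu : {finite_measure set (S1 * S2)%type -> \bar R}) E :
  measurable E -> forall eps : R, 0 < eps ->
  exists A, grid A /\ (mu ((E `\` A) `|` (A `\` E)) < eps%:E)%E.
Proof.
pose C := [set E : set (S1 * S2) | measurable E /\ forall eps : R, 0 < eps ->
  exists A, grid A /\ (mu ((E `\` A) `|` (A `\` E)) < eps%:E)%E].
suff : measurable `<=` C by move=> + mE => /(_ _ mE) [].
have msd (B B' : set (S1 * S2)) : measurable B -> measurable B' ->
    measurable ((B `\` B') `|` (B' `\` B)).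
  by move=> ? ?; apply: measurableU; exact: measurableD.
have CX A B : measurable A -> measurable B -> C (A `*` B).
  move=> mA mB; split; first exact: measurableX.
  move=> eps e0; exists (A `*` B); split; first exact: gridX.
  by rewrite !setDv setU0 measure0 lte_fin.
have CC A : C A -> C (~` A).
  move=> [mA HA]; split; first exact: measurableC.
  move=> eps /HA[B [gB hB]]; exists (~` B); split; first exact: gridC.
  have mB := grid_measurable gB.
  (* Complementing both sets leaves their symmetric difference unchanged. *)
  apply: le_lt_trans hB; rewrite le_measure ?inE//.
  - exact: msd (measurableC _) (measurableC _).
  - exact: msd.
  by move=> x /= [[]|[]] h1 h2; [right|left]; split => //; apply: contrapT.
have C0 : C set0 by have := CX _ _ measurable0 measurable0; rewrite setX0.
have CU A B : C A -> C B -> C (A `|` B).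
  move=> [mA HA] [mB HB]; split; first exact: measurableU.
  move=> eps e0; have e2 : 0 < eps / 2 by rewrite divr_gt0.
  have [A' [gA hA]] := HA _ e2; have [B' [gB hB]] := HB _ e2.
  have mA' := grid_measurable gA; have mB' := grid_measurable gB.
  exists (A' `|` B'); split; first exact: gridU.
  rewrite (splitr eps) EFinD; apply: le_lt_trans (lteD hA hB).
  apply: le_trans (measureU2 _ _ _); [|exact: msd|exact: msd].
  rewrite le_measure ?inE//.
  - exact: msd (measurableU _ _ _ _) (measurableU _ _ _ _).
  - exact: measurableU (msd _ _ _ _) (msd _ _ _ _).
  move=> x /= [[[]h /not_orP[? ?]]|[[]h /not_orP[? ?]]];
   by [left; left|right; left|left; right|right; right].
have CbU (F : nat -> set (S1 * S2)) n : (forall i, C (F i)) ->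
    C (\big[setU/set0]_(i < n) F i).
  move=> CF; elim: n => [|n IH]; last by rewrite big_ord_recr; exact: CU.
  by rewrite big_ord0.
rewrite measurable_prod_measurableType; apply: smallest_sub; last first.
  by move=> _ [A mA [B mB <-]]; exact: CX.
split => //.
  by move=> A CA; rewrite setTD; exact: CC.
move=> F CF; have mF i : measurable (F i) by case: (CF i).
split; first exact: bigcup_measurable.
move=> eps e0; have e2 : 0 < eps / 2 by rewrite divr_gt0.
(* Half of [eps] pays for cutting the countable union down to a finite one, by continuity from
   below; the other half pays for approximating [U n] by a grid. *)
pose U n := \big[setU/set0]_(i < n) F i.
have mU n : measurable (U n) by case: (CbU F n CF).
have UF : \bigcup_n U n = \bigcup_n F n.
  apply/seteqP; split => [x [n _]|x [n _ Fx]].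
    by rewrite /U -bigcup_mkord => -[k _ ?]; exists k.
  by exists n.+1 => //; rewrite /U big_ord_recr; right.
have mUF : measurable (\bigcup_n F n) by exact: bigcup_measurable.
have cv : mu \o U @ \oo --> mu (\bigcup_n F n).
  rewrite -UF; apply: nondecreasing_cvg_mu => //; first by rewrite UF.
  by move=> n m nm; apply/subsetPset; exact: subset_bigsetU.
have fmu : mu (\bigcup_n F n) \is a fin_num by rewrite fin_num_measure.
have [n hn] : exists n, (mu (\bigcup_n F n `\` U n) < (eps / 2)%:E)%E.
  have cvf : fine (mu (U n)) @[n --> \oo] --> fine (mu (\bigcup_n F n)).
    by apply: fine_cvg; rewrite fineK.
  have lt2 : fine (mu (\bigcup_n F n)) - eps / 2 < fine (mu (\bigcup_n F n)).
    by rewrite ltrBlDr ltrDl.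
  have [n _ /(_ _ (leqnn n)) hn] := cvgr_gt _ cvf _ lt2; exists n.
  rewrite measureD//; last by rewrite ltey_eq fmu.
  rewrite setIidr; last by rewrite -UF => x Ux; exists n.
  have fU : mu (U n) \is a fin_num by rewrite fin_num_measure.
  rewrite -[ltLHS]fineK; last by rewrite fin_numB fmu fU.
  rewrite (fineB fmu fU) lte_fin; lra.
have [A [gA hA]] : exists A, grid A /\ (mu ((U n `\` A) `|` (A `\` U n)) < (eps / 2)%:E)%E.
  exact: (CbU F n CF).2.
have mA := grid_measurable gA.
exists A; split => //.
rewrite (splitr eps) EFinD; apply: le_lt_trans (lteD hn hA).
apply: le_trans (measureU2 _ _ _); [|exact: measurableD|exact: msd].
rewrite le_measure ?inE//; [exact: msd|by apply: measurableU; [exact: measurableD|exact: msd]|].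
move=> x [[Fx Ax]|[Ax Fx]].
  have [Ux|Ux] := pselect (U n x); first by right; left.
  by left.
right; right; split => //; apply: contra_not Fx => Ux.
by rewrite -UF; exists n.
Qed.

End grid_approximation.

(** * Expectations of bounded measurable functions *)

Definition bmf {R : realType} {d} {T : measurableType d} (f : T -> R) :=
  measurable_fun setT f /\ exists M, forall x, `|f x| <= M.

Section bmf_theory.
Context {R : realType} d (T : measurableType d).
Implicit Types f g : T -> R.

Lemma bmf_cst (c : R) : bmf (fun _ : T => c).
Proof. by split => //; exists `|c|. Qed.

Lemma bmfD f g : bmf f -> bmf g -> bmf (fun x => f x + g x).
Proof.
move=> [mf [M hM]] [mg [N hN]]; split; first exact: measurable_funD.
by exists (M + N) => x; rewrite (le_trans (ler_normD _ _))// lerD.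
Qed.

Lemma bmfM f g : bmf f -> bmf g -> bmf (fun x => f x * g x).
Proof.
move=> [mf [M hM]] [mg [N hN]]; split; first exact: measurable_funM.
by exists (M * N) => x; rewrite normrM ler_pM.
Qed.

Lemma bmfN f : bmf f -> bmf (fun x => - f x).
Proof.
move=> bf; have := bmfM (bmf_cst (-1)) bf.
by congr bmf; apply/funext => x; rewrite mulN1r.
Qed.

Lemma bmfB f g : bmf f -> bmf g -> bmf (fun x => f x - g x).
Proof. by move=> bf bg; exact: bmfD (bmfN _). Qed.

Lemma bmfX2 f : bmf f -> bmf (fun x => f x ^+ 2).
Proof. by move=> bf; exact: (bmfM bf bf). Qed.

Lemma bmf_sum (I : Type) (s : seq I) (P : pred I) (F : I -> T -> R) :
  (forall i, bmf (F i)) -> bmf (fun x => \sum_(i <- s | P i) F i x).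
Proof.
move=> bF; elim: s => [|i s IH].
  by under eq_fun do rewrite big_nil; exact: bmf_cst.
by under eq_fun do rewrite big_cons; case: (P i) => //; exact: bmfD.
Qed.

Lemma bmf_comp d' (T' : measurableType d') (h : T' -> R) (phi : T -> T') :
  bmf h -> measurable_fun setT phi -> bmf (fun x => h (phi x)).
Proof.
move=> [mh [M hM]] mphi; split; first exact: measurableT_comp.
by exists M => x; exact: hM.
Qed.

Lemma bmf_integrable (mu : {finite_measure set T -> \bar R}) f :
  bmf f -> mu.-integrable setT (EFin \o f).
Proof.
move=> [mf [M hM]]; apply: measurable_bounded_integrable => //.
  by rewrite ltey_eq fin_num_measure.
by exists M; split; [exact: num_real|move=> N MN x _; exact: le_trans (hM x) (ltW MN)].
Qed.

End bmf_theory.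

Section expectation.
Context {R : realType} d (T : measurableType d) (P : probability T R).
Implicit Types f g : T -> R.

Lemma bmf_RintegralD f g : bmf f -> bmf g -> \int[P]_x (f x + g x) = \int[P]_x f x + \int[P]_x g x.
Proof. by move=> bf bg; apply: RintegralD => //; exact: bmf_integrable. Qed.

Lemma bmf_RintegralB f g : bmf f -> bmf g -> \int[P]_x (f x - g x) = \int[P]_x f x - \int[P]_x g x.
Proof. by move=> bf bg; apply: RintegralB => //; exact: bmf_integrable. Qed.

Lemma bmf_RintegralZ (c : R) f : bmf f -> \int[P]_x (c * f x) = c * \int[P]_x f x.
Proof. by move=> bf; apply: RintegralZl => //; exact: bmf_integrable. Qed.

Lemma Rintegral_cst_prob (c : R) : \int[P]_x c = c.
Proof.
rewrite Rintegral_cst// -[RHS]mulr1; congr (_ * _).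
by rewrite -[RHS]/(fine 1%E); congr fine; exact: probability_setT.
Qed.

Lemma bmf_le_Rintegral f g : bmf f -> bmf g -> (forall x, f x <= g x) ->
  \int[P]_x f x <= \int[P]_x g x.
Proof. by move=> bf bg fg; apply: le_Rintegral => //; exact: bmf_integrable. Qed.

Lemma Rintegral_nneg f : (forall x, 0 <= f x) -> 0 <= \int[P]_x f x.
Proof. by move=> f0; apply: Rintegral_ge0. Qed.

Lemma bmf_normr_Rintegral f (M : R) : bmf f -> (forall x, `|f x| <= M) -> `|\int[P]_x f x| <= M.
Proof.
move=> bf fM; have h x : - M <= f x <= M by rewrite -ler_norml.
have bM (c : R) : bmf (fun _ : T => c) by exact: bmf_cst.
have lo : \int[P]_x (- M) <= \int[P]_x f x by apply: bmf_le_Rintegral => // x; case/andP: (h x).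
have hi : \int[P]_x f x <= \int[P]_x M by apply: bmf_le_Rintegral => // x; case/andP: (h x).
by rewrite ler_norml; move: lo hi; rewrite !Rintegral_cst_prob => -> ->.
Qed.

Lemma bmf_Rintegral_sum (I : Type) (s : seq I) (Q : pred I) (F : I -> T -> R) :
  (forall i, bmf (F i)) ->
  \int[P]_x (\sum_(i <- s | Q i) F i x) = \sum_(i <- s | Q i) \int[P]_x F i x.
Proof.
move=> bF; elim: s => [|i s IH].
  under eq_Rintegral do rewrite big_nil.
  by rewrite (Rintegral_cst_prob 0) big_nil.
under eq_Rintegral do rewrite big_cons.
rewrite big_cons; case: (Q i) => //; rewrite -IH bmf_RintegralD//; exact: bmf_sum.
Qed.

Lemma Rintegral_variance f : bmf f ->
  \int[P]_x (f x - \int[P]_y f y) ^+ 2 = \int[P]_x f x ^+ 2 - (\int[P]_x f x) ^+ 2.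
Proof.
move=> bf; set m := \int[P]_y f y.
rewrite (@eq_Rintegral _ _ _ P _ (fun x => (f x ^+ 2 + - 2 * m * f x) + m ^+ 2)); last first.
  by move=> x _; ring.
have b1 := bmfX2 bf; have b2 : bmf (fun x => - 2 * m * f x) by apply: bmfM bf; exact: bmf_cst.
have b12 := bmfD b1 b2; have b3 : bmf (fun _ : T => m ^+ 2) by exact: bmf_cst.
rewrite (bmf_RintegralD b12 b3) (bmf_RintegralD b1 b2) (bmf_RintegralZ _ bf) Rintegral_cst_prob -/m; ring.
Qed.

Lemma sqr_Rintegral_le f : bmf f -> (\int[P]_x f x) ^+ 2 <= \int[P]_x f x ^+ 2.
Proof.
move=> bf; rewrite -subr_ge0 -Rintegral_variance//; apply: Rintegral_nneg => x; exact: sqr_ge0.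
Qed.

(** Lets [square_term] drop the centering: the discarded term is minus a squared mean. *)
Lemma Rintegral_variance_le f : bmf f ->
  \int[P]_x (f x - \int[P]_y f y) ^+ 2 <= \int[P]_x f x ^+ 2.
Proof. by move=> bf; rewrite Rintegral_variance// lerBlDr lerDl sqr_ge0. Qed.

Lemma Rintegral_indic_prob A : measurable A -> \int[P]_x \1_A x = fine (P A).
Proof. by move=> mA; rewrite /Rintegral integral_indic// setIT. Qed.

End expectation.

(** * Product probabilities and Fubini for bounded functions *)

Section fubini.
Context {R : realType} d1 d2 (S1 : measurableType d1) (S2 : measurableType d2).
Variables (P1 : probability S1 R) (P2 : probability S2 R).

(** Named so that the product measure can carry a probability structure, which makes the results on
    bounded functions available for it. *)
Definition prodP := (P1 \x P2)%E.

HB.instance Definition _ := Measure.on prodP.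

Let prodP_setT : prodP setT = 1%E.
Proof.
rewrite -setXTT; apply: etrans (product_measure1E _ _ _ _) _ => //.
by rewrite -[RHS]mule1; congr (_ * _)%E; exact: probability_setT.
Qed.

HB.instance Definition _ := Measure_isProbability.Build _ _ _ prodP prodP_setT.

Lemma bmf_Rintegral1 (h : S1 * S2 -> R) : bmf h ->
  bmf (fun y => \int[P1]_x h (x, y)).
Proof.
move=> bh; have [mh [M hM]] := bh; split; last first.
  exists M => y; apply: bmf_normr_Rintegral; first exact: bmf_comp bh (pair2_measurable y).
  by move=> x; exact: hM.
apply: measurableT_comp => //.
have := @measurable_fubini_G _ _ _ _ R P1 P2 (EFin \o h).
apply; exact: (bmf_integrable [the probability _ _ of prodP]).
Qed.

Lemma Rintegral_prodP (h : S1 * S2 -> R) : bmf h ->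
  \int[prodP]_z h z = \int[P2]_y \int[P1]_x h (x, y).
Proof.
move=> bh; rewrite /Rintegral -(@integral21_prod_meas1 _ _ _ _ R P1 P2 (EFin \o h)); last first.
  exact: (bmf_integrable [the probability _ _ of prodP]).
congr fine; apply: eq_integral => y _; rewrite fineK//.
apply: integrable_fin_num => //.
exact: bmf_integrable (bmf_comp bh (pair2_measurable y)).
Qed.

End fubini.

(** * Decoupling under weak dependence *)

Section finite_measure_add.
Context {R : realType} d (S : measurableType d).
Variables (mu nu : {finite_measure set S -> \bar R}).

(** Approximating under the sum of two laws yields one grid set that is close to the given event
    under both. *)
Definition madd : set S -> \bar R := measure_add mu nu.

HB.instance Definition _ := Measure.on madd.

Let madd_fin : fin_num_fun madd.
Proof. by move=> A mA; rewrite /madd measure_addE fin_numD !fin_num_measure. Qed.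

HB.instance Definition _ := Measure_isFinite.Build _ _ _ madd madd_fin.

Definition finite_measure_add : {finite_measure set S -> \bar R} := madd.

End finite_measure_add.

(** * From closeness of two laws on rectangles to closeness on events and on functions *)

Section close_laws.
Context {R : realType}.

(** The sum counts the positive integers up to [t], so it is the integer part of [t]. *)
Lemma sum_threshold (n : nat) (t : R) : 0 <= t <= n%:R ->
  t - 1 <= \sum_(k < n) ((k.+1%:R <= t)%R%:R : R) <= t.
Proof.
elim: n => [|n IH] /andP[t0 tn]; first by rewrite big_ord0; lra.
rewrite big_ord_recr/=; have [tn'|nt] := leP t n%:R.
  have := IH; rewrite t0 tn' => /(_ isT).
  have -> : (n.+1%:R <= t) = false by apply/negbTE; rewrite -ltNge (le_lt_trans tn')// ltr_nat.
  by rewrite addr0.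
have -> : \sum_(k < n) (k.+1%:R <= t)%R%:R = n%:R :> R.
  rewrite (eq_bigr (fun=> 1)) ?sumr_const ?card_ord// => k _.
  by rewrite (le_trans _ (ltW nt))// ler_nat.
have E : n%:R + 1 = n.+1%:R :> R by rewrite natr1.
by case: (leP n.+1%:R t) => /= h; rewrite ?addr0; apply/andP; split; lra.
Qed.

(** Up to [1/n], [h] is an average of [n] indicators of superlevel sets. An average of differences
    bounded by [b] is bounded by [b], and [n] is arbitrary. *)
Lemma Rintegral_close d (S : measurableType d) (mu nu : probability S R) (b : R)
  (h : S -> R) :
  (forall E, measurable E -> `|fine (mu E) - fine (nu E)| <= b) ->
  measurable_fun setT h -> (forall x, 0 <= h x <= 1) ->
  `|\int[mu]_x h x - \int[nu]_x h x| <= b.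
Proof.
move=> hb mh h01.
have bh : bmf h.
  split => //; exists 1 => x; have /andP[h0 h1] := h01 x.
  by rewrite ger0_norm.
apply/ler_addgt0Pr => e e0.
have [N hN] : exists N : nat, e^-1 < N.+1%:R.
  have [N _ hN] := nbhs_infty_gtr e^-1; exists N; exact: hN (leqnSn _).
pose n : R := N.+1%:R.
have n0 : 0 < n by rewrite ltr0n.
have ne : n^-1 < e by rewrite invf_plt ?posrE.
pose E (k : nat) := [set x | k.+1%:R <= h x * n].
have mE k : measurable (E k).
  have mhn : measurable_fun setT (fun x => h x * n) by exact: measurable_funM.
  rewrite -[E k]setTI; have -> : E k = (fun x => h x * n) @^-1` `[k.+1%:R, +oo[%classic.
    by apply/seteqP; split => x /=; rewrite in_itv/= andbT.
  exact: mhn.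
(* By [sum_threshold], [q x] is [h x] rounded down to a multiple of [1/n]. *)
pose q x := n^-1 * \sum_(k < N.+1) \1_(E k) x : R.
have bE k : bmf (\1_(E k) : S -> R).
  split; first exact: measurable_indic.
  by exists 1 => x; rewrite indicE; case: (_ \in _); rewrite /= ?normr1 ?normr0.
have bS : bmf (fun x => \sum_(k < N.+1) (\1_(E k) x : R)).
  by apply: bmf_sum => k; exact: bE.
have bq : bmf q by apply: bmfM bS; exact: bmf_cst.
have hq x : h x - n^-1 <= q x <= h x.
  have /andP[h0 h1] := h01 x.
  have /sum_threshold : 0 <= h x * n <= n by rewrite mulr_ge0 ?ler_piMl// ltW.
  have -> : q x = n^-1 * \sum_(k < N.+1) ((k.+1%:R <= h x * n)%R%:R : R).
    congr (_ * _); apply: eq_bigr => k _; rewrite indicE; congr (nat_of_bool _)%:R.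
    by apply/idP/idP => [/set_mem|? ]//; rewrite mem_set.
  move=> /andP[l u]; rewrite mulrC ler_pdivrMr// u andbT ler_pdivlMr//.
  by rewrite mulrBl mulVf ?gt_eqF.
have Eq (m : probability S R) : \int[m]_x q x = n^-1 * \sum_(k < N.+1) fine (m (E k)).
  rewrite bmf_RintegralZ// bmf_Rintegral_sum//; congr (_ * _).
  by apply: eq_bigr => k _; exact: Rintegral_indic_prob.
have H (m : probability S R) : \int[m]_x q x <= \int[m]_x h x <= \int[m]_x q x + n^-1.
  have bc : bmf (fun _ : S => n^-1) by exact: bmf_cst.
  have bqc := bmfD bq bc.
  have -> : \int[m]_x q x + n^-1 = \int[m]_x (q x + n^-1) by rewrite bmf_RintegralD// Rintegral_cst_prob.
  by apply/andP; split; apply: bmf_le_Rintegral => // x; have /andP[] := hq x; rewrite ?lerBlDr.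
have D : `|\int[mu]_x q x - \int[nu]_x q x| <= b.
  rewrite !Eq -mulrBr -sumrB normrM gtr0_norm ?invr_gt0//.
  rewrite mulrC ler_pdivrMr//; apply: le_trans (ler_norm_sum _ _ _) _.
  apply: le_trans (ler_sum _ _) _; first by move=> k _; exact: hb.
  by rewrite sumr_const card_ord -mulr_natr.
(* Rounding down errs in the same direction under both laws, so [1/n] is paid only once. *)
move: D (H mu) (H nu) ne; move: (n^-1) => i; rewrite !ler_norml => /andP[? ?] /andP[? ?] /andP[? ?] ?.
apply/andP; split; lra.
Qed.

(** On a grid set the difference of the two laws is a sum over some of the cells, hence at most the
    full sum of absolute values. [grid_approx] carries the bound to every event. *)
Lemma close_grid d1 d2 (S1 : measurableType d1) (S2 : measurableType d2)
  (mu nu : probability (S1 * S2)%type R) (b : R) :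
  (forall (J K : finType) (a : S1 -> J) (c : S2 -> K), classifier a -> classifier c ->
    \sum_j \sum_k `|fine (mu ((a @^-1` [set j]) `*` (c @^-1` [set k])))
                   - fine (nu ((a @^-1` [set j]) `*` (c @^-1` [set k])))| <= b) ->
  forall E, measurable E -> `|fine (mu E) - fine (nu E)| <= b.
Proof.
move=> hb E mE.
have gridb A : grid A -> `|fine (mu A) - fine (nu A)| <= b.
  move=> [J [K [a [c [T [ma mc ->]]]]]].
  have m : classifier (fun z : (S1 * S2)%type => (a z.1, c z.2)).
    by apply: classifier_pair; exact: classifier_comp.
  have H (m0 : probability (S1 * S2)%type R) : fine (m0 [set z | T (a z.1) (c z.2)]) =
      \sum_(p : J * K | T p.1 p.2) fine (m0 ((a @^-1` [set p.1]) `*` (c @^-1` [set p.2]))).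
    rewrite (fine_measure_classifier m0 (fun p : (J * K)%type => T p.1 p.2) m).
    apply: eq_bigr => -[j k] _; congr (fine (m0 _)).
    by apply/seteqP; split => x /= => [[-> ->]|[-> ->]].
  rewrite !H -sumrB; apply: le_trans (ler_norm_sum _ _ _) _.
  apply: le_trans (hb _ _ _ _ ma mc); rewrite pair_big/= big_mkcond/=.
  by apply: ler_sum => p _; case: ifP.
apply/ler_addgt0Pr => e e0; have e2 : 0 < e / 2 by rewrite divr_gt0.
(* The error [e] bounds the symmetric difference under [mu] and [nu] together. *)
have [A [gA hA]] := grid_approx (finite_measure_add mu nu) mE e0.
have mA := grid_measurable gA.
have mD : measurable ((E `\` A) `|` (A `\` E)).
  by apply: measurableU; exact: measurableD.
move: hA; rewrite /finite_measure_add/= /madd measure_addE => hA.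
have fm (m : probability (S1 * S2)%type R) : 
    `|fine (m E) - fine (m A)| <= fine (m ((E `\` A) `|` (A `\` E))).
  have sub (B C : set (S1 * S2)) : measurable B -> measurable C ->
      B `<=` C `|` ((E `\` A) `|` (A `\` E)) -> 
      fine (m B) <= fine (m C) + fine (m ((E `\` A) `|` (A `\` E))).
    move=> mB mC BC; rewrite -fineD ?fin_num_measure//; apply: fine_le.
    - by rewrite fin_num_measure.
    - by rewrite fin_numD !fin_num_measure.
    apply: le_trans (measureU2 _ _ _) => //; rewrite le_measure ?inE//.
    exact: measurableU.
  have h1 := sub E A mE mA; have h2 := sub A E mA mE.
  have {}h1 := h1 _; have {}h2 := h2 _.
  rewrite ler_norml; apply/andP; split.
    have : fine (m A) <= fine (m E) + fine (m ((E `\` A) `|` (A `\` E))).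
      apply: h2 => x Ax; have [Ex|Ex] := pselect (E x); [by left|by right; right].
    lra.
  have : fine (m E) <= fine (m A) + fine (m ((E `\` A) `|` (A `\` E))).
    apply: h1 => x Ax; have [Ex|Ex] := pselect (A x); [by left|by right; left].
  lra.
have he : fine (mu ((E `\` A) `|` (A `\` E))) + fine (nu ((E `\` A) `|` (A `\` E))) < e.
  by rewrite -fineD ?fin_num_measure// -lte_fin fineK// fin_numD !fin_num_measure.
move: (fm mu) (fm nu) (gridb _ gA) he; rewrite !ler_norml => /andP[? ?] /andP[? ?] /andP[? ?] ?.
apply/andP; split; lra.
Qed.

End close_laws.

Section law.
Context {R : realType} d (T : measurableType d) (P : probability T R).
Context d1 (S : measurableType d1) (X : T -> S) (mX : measurable_fun setT X).

Definition law : probability S R := distribution P (mfun_Sub (mem_set mX)).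

Lemma Rintegral_law (h : S -> R) : bmf h -> \int[law]_x h x = \int[P]_w h (X w).
Proof.
move=> bh; congr fine; apply: (@integral_distribution _ _ _ _ _ P (mfun_Sub (mem_set mX)) (EFin \o h)).
  by apply/measurable_EFinP; case: bh.
exact: (bmf_integrable P (bmf_comp bh mX)).
Qed.

End law.

Section decoupling.
Context {R : realType} d (T : measurableType d) (P : probability T R).
(** A bound on twice the beta coefficient of the sigma-fields generated by [X] and [Y]: the factor
    1/2 is dropped, and partitions are given by classifiers. *)
Definition dependence_le {d1 d2} {S1 : measurableType d1} {S2 : measurableType d2}
  (X : T -> S1) (Y : T -> S2) (b : R) :=
  forall (J K : finType) (a : S1 -> J) (c : S2 -> K), classifier a -> classifier c ->
    \sum_j \sum_k `|fine (P ((X @^-1` (a @^-1` [set j])) `&` (Y @^-1` (c @^-1` [set k]))))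
      - fine (P (X @^-1` (a @^-1` [set j]))) * fine (P (Y @^-1` (c @^-1` [set k])))| <= b.

Definition independent {d1 d2} {S1 : measurableType d1} {S2 : measurableType d2}
  (X : T -> S1) (Y : T -> S2) := forall A B, measurable A -> measurable B ->
  P (X @^-1` A `&` Y @^-1` B) = (P (X @^-1` A) * P (Y @^-1` B))%E.

Lemma measurable_preim {d1} {S1 : measurableType d1} (X : T -> S1) A :
  measurable_fun setT X -> measurable A -> measurable (X @^-1` A).
Proof. by move=> mX mA; rewrite -[_ @^-1` _]setTI; exact: mX. Qed.

Context d1 d2 (S1 : measurableType d1) (S2 : measurableType d2).

Lemma independent_dependence (X : T -> S1) (Y : T -> S2) :
  measurable_fun setT X -> measurable_fun setT Y ->
  independent X Y -> dependence_le X Y 0.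
Proof.
move=> mX mY iXY J K a c ma mc; rewrite big1// => j _; rewrite big1// => k _.
rewrite iXY ?fineM ?subrr ?normr0//; apply: fin_num_measure; exact: measurable_preim.
Qed.

(** The two integrals are those of [h] under the joint law of [(X, Y)] and under the product of the
    marginals. The dependence bound controls these laws on rectangles, so [close_grid] and then
    [Rintegral_close] apply. *)
Lemma decouple (X : T -> S1) (Y : T -> S2) (b M : R) (h : S1 * S2 -> R) :
  measurable_fun setT X -> measurable_fun setT Y -> dependence_le X Y b ->
  measurable_fun setT h -> 0 < M -> (forall z, `|h z| <= M) ->
  `|\int[P]_w h (X w, Y w) - \int[P]_w \int[P]_w' h (X w', Y w)| <= 2 * M * b.
Proof.
move=> mX mY dXY mh M0 hM.
have bh : bmf h by split=> //; exists M.
have mXY : measurable_fun setT (fun w => (X w, Y w)) by exact: measurable_fun_pair.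
pose mu := law P mXY.
pose nu : probability (S1 * S2)%type R := prodP (law P mX) (law P mY).
have -> : \int[P]_w h (X w, Y w) = \int[mu]_z h z by rewrite Rintegral_law.
have -> : \int[P]_w \int[P]_w' h (X w', Y w) = \int[nu]_z h z.
  rewrite Rintegral_prodP//; transitivity (\int[P]_w \int[law P mX]_x h (x, Y w)).
    apply: eq_Rintegral => w _; rewrite Rintegral_law//.
    exact: bmf_comp bh (pair2_measurable _).
  by rewrite -(Rintegral_law P mY (bmf_Rintegral1 (law P mX) (law P mY) bh)).
(* Affine rescaling of [[-M, M]] onto [[0, 1]], the source of the factor [2 * M]; the shift cancels
   in the difference. *)
pose h' z := (2 * M)^-1 * (h z + M).
have M2 : 0 < 2 * M by rewrite mulr_gt0.
have cM : bmf (fun _ : (S1 * S2)%type => M) by exact: bmf_cst.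
have bh' : bmf h' by apply: bmfM; [exact: bmf_cst|exact: bmfD].
have hE (m : probability (S1 * S2)%type R) :
    \int[m]_z h z = 2 * M * \int[m]_z h' z - M.
  rewrite bmf_RintegralZ ?bmf_RintegralD ?Rintegral_cst_prob//; last exact: bmfD.
  by rewrite mulrA mulfV ?mul1r ?gt_eqF// addrK.
rewrite !hE opprB addrA subrK -mulrBr normrM gtr0_norm// ler_pM2l//.
apply: Rintegral_close; [|by case: bh'|]; last first.
  move=> z; have := hM z; rewrite ler_norml => /andP[l u]; apply/andP; split.
    by apply: mulr_ge0; [rewrite invr_ge0 ltW|lra].
  by rewrite /h' mulrC ler_pdivrMr//; lra.
apply: close_grid => J K a c ma mc; apply: le_trans (dXY J K a c ma mc).
apply: ler_sum => j _; apply: ler_sum => k _; rewrite le_eqVlt; apply/orP; left.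
apply/eqP; congr `|_ - _|.
rewrite -fineM; last 2 first.
- by apply: fin_num_measure; exact: measurable_preim.
- by apply: fin_num_measure; exact: measurable_preim.
congr fine; exact: (product_measure1E (law P mX) (law P mY) (ma j) (mc k)).
Qed.

Lemma decouple_indep (X : T -> S1) (Y : T -> S2) (h : S1 * S2 -> R) :
  measurable_fun setT X -> measurable_fun setT Y -> independent X Y ->
  bmf h -> \int[P]_w h (X w, Y w) = \int[P]_w \int[P]_w' h (X w', Y w).
Proof.
move=> mX mY iXY [mh [M hM]].
(* This is [decouple] with dependence 0; it asks for a positive bound, which [M] itself need not
   be. *)
have M0 : 0 < `|M| + 1 by rewrite ltr_pwDr.
have hM' z : `|h z| <= `|M| + 1.
  by rewrite (le_trans (hM z))// (le_trans (ler_norm _))// lerDl.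
have := decouple mX mY (independent_dependence mX mY iXY) mh M0 hM'.
by rewrite mulr0 normr_le0 subr_eq0 => /eqP.
Qed.
End decoupling.

(** Independence of [W] from [(X, V)] allows integrating over [W] last in both terms. For each
    frozen value of [W], [decouple] applies to [X] and [V]. *)
Lemma decouple3 {R : realType} d (T : measurableType d) (P : probability T R)
  d1 d2 d3 (S1 : measurableType d1) (S2 : measurableType d2) (S3 : measurableType d3)
  (X : T -> S1) (V : T -> S2) (W : T -> S3) (b M : R)
  (h : S1 * (S2 * S3) -> R) :
  measurable_fun setT X -> measurable_fun setT V -> measurable_fun setT W ->
  dependence_le P X V b -> independent P (fun w => (X w, V w)) W ->
  measurable_fun setT h -> 0 < M -> (forall z, `|h z| <= M) ->
  `|\int[P]_w h (X w, (V w, W w))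
    - \int[P]_w \int[P]_w' h (X w', (V w, W w))| <= 2 * M * b.
Proof.
move=> mX mV mW dXV iXVW mh M0 hM.
have bh : bmf h by split=> //; exists M.
have mXV : measurable_fun setT (fun w => (X w, V w)) by exact: measurable_fun_pair.
have iVW : independent P V W.
  move=> A B mA mB; have := iXVW (setT `*` A) B (measurableX measurableT mA) mB.
  have -> // : (fun w => (X w, V w)) @^-1` (setT `*` A) = V @^-1` A.
  by apply/seteqP; split => x //= [].
pose h1 (z : (S1 * S2) * S3) := h (z.1.1, (z.1.2, z.2)).
have bh1 : bmf h1.
  apply: (bmf_comp bh); apply: measurable_fun_pair.
    by apply: measurableT_comp; [exact: measurable_fst|exact: measurable_fst].
  apply: measurable_fun_pair => //.
  by apply: measurableT_comp; [exact: measurable_snd|exact: measurable_fst].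
have E1 : \int[P]_w h (X w, (V w, W w)) =
    \int[P]_w \int[P]_w' h (X w', (V w', W w)).
  exact: (decouple_indep mXV mW iXVW bh1).
pose g (z : S2 * S3) := \int[P]_w h (X w, z).
have bg : bmf g.
  have mVW : measurable_fun setT (fun w => (V w, W w)) by exact: measurable_fun_pair.
  have := bmf_Rintegral1 (law P mX) (law P mVW) bh.
  congr bmf; apply/funext => z; rewrite Rintegral_law//.
  exact: bmf_comp bh (pair2_measurable _).
have E2 : \int[P]_w g (V w, W w) = \int[P]_w \int[P]_w' g (V w', W w).
  exact: decouple_indep.
rewrite E1 E2.
have b2 : bmf (fun w => \int[P]_w' g (V w', W w)).
  apply: (bmf_comp (phi := W) (h := fun t => \int[P]_w' g (V w', t))) => //.
  have := bmf_Rintegral1 (law P mV) (law P mW) bg.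
  congr bmf; apply/funext => z; rewrite Rintegral_law//.
  exact: bmf_comp bg (pair2_measurable _).
have b1 : bmf (fun w => \int[P]_w' h (X w', (V w', W w))).
  apply: (bmf_comp (phi := W) (h := fun t => \int[P]_w' h (X w', (V w', t)))) => //.
  have := bmf_Rintegral1 (law P mXV) (law P mW) bh1.
  congr bmf; apply/funext => z; rewrite Rintegral_law//.
  exact: bmf_comp bh1 (pair2_measurable _).
rewrite -bmf_RintegralB//; apply: bmf_normr_Rintegral; first exact: bmfB.
move=> w.
have mhw : measurable_fun setT (fun z : (S1 * S2)%type => h (z.1, (z.2, W w))).
  apply: (measurableT_comp mh); apply: measurable_fun_pair => //.
  exact: measurable_fun_pair.
exact: (decouple mX mV dXV mhw M0 (fun z => hM _)).
Qed.

(** Uniqueness of measures: rectangles are stable under intersection and generate the product, and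
    on them the triple product formula gives the claim. *)
Lemma independent_pair {R : realType} d (T : measurableType d) (P : probability T R)
  d1 d2 d3 (S1 : measurableType d1) (S2 : measurableType d2) (S3 : measurableType d3)
  (X : T -> S1) (Y : T -> S2) (W : T -> S3) :
  measurable_fun setT X -> measurable_fun setT Y -> measurable_fun setT W ->
  (forall A B C, measurable A -> measurable B -> measurable C ->
    P (X @^-1` A `&` Y @^-1` B `&` W @^-1` C) =
      (P (X @^-1` A) * P (Y @^-1` B) * P (W @^-1` C))%E) ->
  independent P (fun w => (X w, Y w)) W.
Proof.
move=> mX mY mW H E C mE mC.
have mXY : measurable_fun setT (fun w => (X w, Y w)) by exact: measurable_fun_pair.
have mWC : measurable (W @^-1` C) by exact: measurable_preim.
have fC : P (W @^-1` C) \is a fin_num by exact: fin_num_measure.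
have C0 : 0 <= fine (P (W @^-1` C)) by rewrite fine_ge0.
(* For fixed [C], [m1] is the law of [(X, Y)] restricted to the event that [W] lies in [C], and [m2]
   is the law of [(X, Y)] scaled by the probability of that event. *)
pose m1 := pushforward (mrestr P mWC) (mfun_Sub (mem_set mXY)).
pose m2 := mscale (NngNum C0) (law P mXY).
have m2E A : m2 A = (P (W @^-1` C) * P ((fun w => (X w, Y w)) @^-1` A))%E.
  by rewrite -[in RHS](fineK fC).
have XYE (A : set S1) (B : set S2) :
    (fun w => (X w, Y w)) @^-1` (A `*` B) = X @^-1` A `&` Y @^-1` B by [].
have HXY (A : set S1) (B : set S2) : measurable A -> measurable B ->
    P (X @^-1` A `&` Y @^-1` B) = (P (X @^-1` A) * P (Y @^-1` B))%E.
  move=> mA mB; have := H A B setT mA mB measurableT.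
  by rewrite preimage_setT setIT probability_setT mule1.
have : m1 E = m2 E.
  apply: (measure_unique [set A `*` B | A in measurable & B in measurable] (fun=> setT)) => //.
  - exact: measurable_prod_measurableType.
  - move=> _ _ [A mA [B mB <-]] [A' mA' [B' mB' <-]].
    exists (A `&` A'); first exact: measurableI.
    by exists (B `&` B'); [exact: measurableI|rewrite setXI].
  - by move=> _; exists setT => //; exists setT => //; rewrite setXTT.
  - by rewrite bigcup_const//; exists 0%N.
  - move=> _ [A mA [B mB <-]]; rewrite -[RHS]/(m2 (A `*` B)) m2E.
    rewrite -[LHS]/(P ((X @^-1` A `&` Y @^-1` B) `&` W @^-1` C)) H//.
    by rewrite XYE HXY// muleC.
  - move=> _; rewrite /m1; apply: le_lt_trans (_ : P setT < +oo)%E; last first.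
      by rewrite ltey_eq fin_num_measure.
    apply: le_measure; rewrite ?inE//.
    by rewrite /= preimage_setT setTI.
by rewrite m2E muleC.
Qed.

Lemma sub_independent {R : realType} d (T : measurableType d) (P : probability T R)
  d1 d2 d3 (S1 : measurableType d1) (S2 : measurableType d2) (S3 : measurableType d3)
  (X : T -> S1) (W : T -> S3) (phi : S1 -> S2) :
  measurable_fun setT phi -> independent P X W -> independent P (phi \o X) W.
Proof.
move=> mphi iXW A B mA mB; rewrite comp_preimage.
by apply: iXW => //; exact: measurable_preim.
Qed.

(** * Sigma-fields generated by subfamilies, and their beta coefficients *)

Section sigma_fields.
Context (T : Type) d (XM : measurableType d) (n : nat).
Implicit Types (Z Y : 'I_n -> T -> XM) (S : {set 'I_n}).

Lemma sigmaS_sigma_algebra Z S : sigma_algebra setT (sigmaS Z S).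
Proof. exact: smallest_sigma_algebra. Qed.

Lemma sigmaS_preimage Z S i B : i \in S -> measurable B -> sigmaS Z S (Z i @^-1` B).
Proof.
move=> iS mB; apply: sub_sigma_algebra; exists i => //; exists B => //.
by rewrite setTI.
Qed.

(** The sets with preimage in [sigmaS Z S] form a sigma-algebra, so coordinate cylinders suffice.
    [Y] differs from [Z] to allow constant coordinates, as in [excl]. *)
Lemma sigmaS_tuple Z S Y :
  (forall k B, measurable B -> sigmaS Z S (Y k @^-1` B)) ->
  forall A, measurable A -> sigmaS Z S ((fun w => [tuple Y k w | k < n]) @^-1` A).
Proof.
move=> H A mA.
suff /(_ A mA) : measurable `<=` image_set_system setT (fun w => [tuple Y k w | k < n])
    (sigmaS Z S) by rewrite /image_set_system/= setTI.
apply: smallest_sub.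
  by apply: sigma_algebra_image; exact: sigmaS_sigma_algebra.
rewrite -bigcup_seq/=; apply: bigcup_sub => i _ _ [B mB <-].
rewrite /image_set_system/= !setTI.
have := H i B mB; congr (sigmaS Z S _); apply/seteqP; split => w /=;
  by rewrite tnth_mktuple.
Qed.

End sigma_fields.

Section beta_dependence.
Context {R : realType} d (T : measurableType d) (P : probability T R).
Context dX (XM : measurableType dX) (n : nat).

Lemma measurable_tuple (Y : 'I_n -> T -> XM) : (forall i, measurable_fun setT (Y i)) ->
  measurable_fun setT (fun w => [tuple Y k w | k < n]).
Proof.
move=> mY; apply/measurable_fun_tnthP => i.
rewrite (_ : _ \o _ = Y i); first exact: mY.
by apply/funext => w /=; rewrite tnth_mktuple.
Qed.

Lemma fin_partition_classifier d1 (S1 : measurableType d1) (A : set (set T))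
  (X : T -> S1) (J : finType) (a : S1 -> J) :
  (forall B, measurable B -> A (X @^-1` B)) -> classifier a ->
  fin_partition A (fun j : 'I_#|J| => X @^-1` (a @^-1` [set enum_val j])).
Proof.
move=> HA ma; split; first by move=> j; exact: HA.
split.
  move=> j j' jj'; apply/seteqP; split => w //= [ej ej'].
  by move: jj'; rewrite (enum_val_inj (etrans (esym ej) ej')) eqxx.
apply/seteqP; split => w // _; rewrite -bigcup_seq.
exists (enum_rank (a (X w))) => /=; first by rewrite mem_index_enum.
by rewrite enum_rankK.
Qed.

Lemma beta_dependence d1 d2 (S1 : measurableType d1) (S2 : measurableType d2)
  (X : T -> S1) (Y : T -> S2) (A B : set (set T)) (b : R) :
  measurable_fun setT X -> measurable_fun setT Y ->
  (forall C, measurable C -> A (X @^-1` C)) ->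
  (forall C, measurable C -> B (Y @^-1` C)) ->
  (beta_coef P A B <= b%:E)%E -> dependence_le P X Y (2 * b).
Proof.
move=> mX mY HA HB hb J K a c ma mc.
pose F (j : 'I_#|J|) := X @^-1` (a @^-1` [set enum_val j]).
pose H (k : 'I_#|K|) := Y @^-1` (c @^-1` [set enum_val k]).
have mF j : measurable (F j) by exact: measurable_preim.
have mH k : measurable (H k) by exact: measurable_preim.
have : ((2^-1)%:E * \sum_(j < #|J|) \sum_(k < #|K|)
             `| P (F j `&` H k) - P (F j) * P (H k) | <= b%:E)%E.
  apply: le_trans hb; apply: ereal_sup_ubound; exists #|J|, #|K|, F, H.
  by split; [exact: fin_partition_classifier|split; [exact: fin_partition_classifier|]].
have -> : (\sum_(j < #|J|) \sum_(k < #|K|)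
             `| P (F j `&` H k) - P (F j) * P (H k) |)%E =
  (\sum_(j < #|J|) \sum_(k < #|K|) `| fine (P (F j `&` H k))
     - fine (P (F j)) * fine (P (H k)) |)%:E.
  rewrite -sumEFin; apply: eq_bigr => j _; rewrite -sumEFin; apply: eq_bigr => k _.
  rewrite -abse_EFin EFinB EFinM !fineK//; apply: fin_num_measure => //.
  exact: measurableI.
rewrite -EFinM lee_fin mulrC ler_pdivrMr// mulrC.
congr (_ <= _); rewrite [RHS](reindex _ (onW_bij _ (enum_val_bij J))).
apply: eq_bigr => j _; rewrite [RHS](reindex _ (onW_bij _ (enum_val_bij K))).
by apply: eq_bigr => k _.
Qed.

End beta_dependence.

(** * The second moment of the sum for a fixed sample size *)

Lemma bmf_int {R : realType} d (T : measurableType d) (P : probability T R)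
  d1 d2 (S1 : measurableType d1) (S2 : measurableType d2) (X : T -> S1) (Y : T -> S2)
  (h : S1 * S2 -> R) : measurable_fun setT X -> measurable_fun setT Y ->
  bmf h -> bmf (fun y => \int[P]_w h (X w, y)).
Proof.
move=> mX mY bh; have := bmf_Rintegral1 (law P mX) (law P mY) bh.
congr bmf; apply/funext => z; rewrite Rintegral_law//.
exact: bmf_comp bh (pair2_measurable _).
Qed.

(** Expand the square and bound each product by the mean of the two squares. *)
Lemma sqr_sum_le {R : realFieldType} (n : nat) (x : 'I_n -> R) :
  (\sum_i x i) ^+ 2 <= n%:R * \sum_i x i ^+ 2.
Proof.
have -> : n%:R * \sum_i x i ^+ 2 = \sum_i \sum_j ((x i ^+ 2 + x j ^+ 2) / 2).
  have inner i : \sum_j ((x i ^+ 2 + x j ^+ 2) / 2) =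
      (n%:R * x i ^+ 2 + \sum_j x j ^+ 2) / 2.
    by rewrite -mulr_suml big_split/= sumr_const card_ord mulr_natl.
  rewrite [RHS](eq_bigr _ (fun i _ => inner i)).
  rewrite -mulr_suml big_split/= sumr_const card_ord -mulr_sumr.
  rewrite -[(\sum_(j < n) _) *+ n]mulr_natl; by field.
rewrite expr2 big_distrlr/=; apply: ler_sum => i _; apply: ler_sum => j _.
rewrite ler_pdivlMr// -subr_ge0 (_ : _ - _ = (x i - x j) ^+ 2) ?sqr_ge0//; ring.
Qed.

Lemma sum4_le {R : realFieldType} (x1 x2 x3 x4 a c : R) :
  x1 <= a -> x2 <= c -> x3 <= c -> - c <= x4 -> x1 + x2 + x3 - x4 <= a + 3 * c.
Proof. by move=> *; lra. Qed.

Section finite_sample.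
Context {R : realType} d (T : measurableType d) (P : probability T R).
Context dX (XM : measurableType dX) (n : nat) (Z Zt Zs : 'I_n -> T -> XM).
(** In the application [v (z, x)] is the value of [f] at [z] for the learner trained on [x], minus
    that for [g0]. [b], [delta] and [kappa] bound the beta coefficient, the squared stability error
    and the consistency error. *)
Variables (rho : 'I_n -> 'I_n -> R) (r : R) (v : XM * n.-tuple XM -> R).
Variables (B b delta kappa : R) (pt : XM).
Hypothesis rho_sym : forall i j, rho i j = rho j i.
Hypothesis mZ : forall i, measurable_fun setT (Z i).
Hypothesis mZt : forall i, measurable_fun setT (Zt i).
Hypothesis mZs : forall i, measurable_fun setT (Zs i).
Hypothesis law_s : same_law P (dataset Z) (dataset Zs).
Hypothesis ind : indep3 P (sigmaS Z [set: 'I_n]%SET) (sigmaS Zt [set: 'I_n]%SET)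
  (sigmaS Zs [set: 'I_n]%SET).
Hypothesis mv : measurable_fun setT v.
Hypothesis B0 : 0 < B.
Hypothesis vB : forall z, `|v z| <= B.
Hypothesis b0 : 0 <= b.
Hypothesis beta_b : (beta_n P Z rho r <= b%:E)%E.

Local Notation DZ := (dataset Z).
Local Notation DZt := (dataset Zt).
Local Notation DZs := (dataset Zs).
Local Notation N := (fun i => nbhd rho i r).

(** An arbitrary mask treats resampling around one index and around two alike, and a function of the
    two data sets can also be fed [excl] in place of the original data. *)
Definition mix (m : pred 'I_n) (p : n.-tuple XM * n.-tuple XM) : n.-tuple XM :=
  [tuple if m k then tnth p.2 k else tnth p.1 k | k < n].

Definition masked (m : pred 'I_n) (w : T) := mix m (DZ w, DZt w).

(* [pt] is an arbitrary filler for the coordinates near [j]. *)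
Definition excl (j : 'I_n) (w : T) : n.-tuple XM :=
  [tuple if k \in N j then pt else Z k w | k < n].

Lemma measurable_mix m : measurable_fun setT (mix m).
Proof.
apply: measurable_tuple => i; case: (m i).
  exact: (measurableT_comp (measurable_tnth i) measurable_snd).
exact: (measurableT_comp (measurable_tnth i) measurable_fst).
Qed.

Let mDZ : measurable_fun setT DZ. Proof. exact: measurable_tuple. Qed.
Let mDZt : measurable_fun setT DZt. Proof. exact: measurable_tuple. Qed.
Let mDZs : measurable_fun setT DZs. Proof. exact: measurable_tuple. Qed.

Lemma measurable_masked m : measurable_fun setT (masked m).
Proof.
by apply: (measurableT_comp (measurable_mix m)); exact: measurable_fun_pair.
Qed.

Lemma measurable_excl j : measurable_fun setT (excl j).
Proof. by apply: measurable_tuple => k; case: (k \in N j). Qed.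

(** All coordinates near [j] come from the copy, so the filler is never read. *)
Lemma masked_excl (m : pred 'I_n) j w : {in N j, forall k, m k} ->
  masked m w = mix m (excl j w, DZt w).
Proof.
move=> mj; apply: eq_from_tnth => k; rewrite !tnth_mktuple/= ?tnth_mktuple.
by case: ifPn => // /negP mk; case: ifP => // /mj.
Qed.

Lemma dataset_repl_masked i j w :
  dataset_repl Z Zt rho r i j w = masked (fun k => (k \in N i) || (k \in N j)) w.
Proof. by apply: eq_from_tnth => k; rewrite !tnth_mktuple/= ?tnth_mktuple. Qed.

Let indT A C E : measurable A -> measurable C -> measurable E ->
  P (DZ @^-1` A `&` DZt @^-1` C `&` DZs @^-1` E) =
  (P (DZ @^-1` A) * P (DZt @^-1` C) * P (DZs @^-1` E))%E.
Proof.
by move=> mA mC mE; apply: ind; apply: sigmaS_tuple => // k F mF;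
  apply: sigmaS_preimage; rewrite ?inE.
Qed.

Lemma independent_Zt : independent P DZ DZt.
Proof.
move=> A C mA mC; have := indT mA mC measurableT.
by rewrite preimage_setT setIT probability_setT mule1.
Qed.

Lemma independent_Zs i : independent P (Zs i) (fun w => (DZ w, DZt w)).
Proof.
have H := independent_pair mDZ mDZt mDZs indT.
move=> A C mA mC.
have E : Zs i @^-1` A = DZs @^-1` ((@tnth n XM ^~ i) @^-1` A).
  by apply/seteqP; split => w /=; rewrite tnth_mktuple.
rewrite E setIC muleC; apply: H => //.
by apply: measurable_preim => //; exact: measurable_tnth.
Qed.

Lemma dependence_excl j : dependence_le P (Z j) (excl j) (2 * b).
Proof.
apply: (beta_dependence (A := sigmaS Z [set j]%SET) (B := sigmaS Z (~: N j)%SET)) => //.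
- exact: measurable_excl.
- by move=> C mC; apply: sigmaS_preimage; rewrite ?inE.
- move=> C mC; apply: sigmaS_tuple => // k D mD; case: (boolP (k \in nbhd rho j r)) => kj; last first.
    by apply: sigmaS_preimage => //; rewrite inE.
  have [S0 SC SU] := sigmaS_sigma_algebra Z (~: nbhd rho j r)%SET.
  (* A filler coordinate is constant: its preimages are the whole space or empty. *)
  have [Dpt|Dpt] := pselect (D pt).
    have -> : (fun=> pt) @^-1` D = setT `\` set0 :> set T by apply/seteqP; split => w // _; split.
    exact: SC.
  by have -> : (fun=> pt) @^-1` D = set0 :> set T by apply/seteqP; split.
apply: le_trans beta_b; apply: ereal_sup_ubound.
exists [set j]%SET, (~: N j)%SET; split; first by rewrite cards1.
split => // i k; rewrite !inE => /eqP ->.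
by rewrite -ltNge.
Qed.

Lemma independent_excl j : independent P (fun w => (Z j w, excl j w)) DZt.
Proof.
pose phi (x : n.-tuple XM) := (tnth x j, [tuple if k \in N j then pt else tnth x k | k < n]).
have -> : (fun w => (Z j w, excl j w)) = phi \o DZ.
  apply/funext => w; rewrite /phi/= tnth_mktuple; congr (_, _).
  by apply: eq_from_tnth => k; rewrite !tnth_mktuple.
apply: sub_independent; last exact: independent_Zt.
apply: measurable_fun_pair; first exact: measurable_tnth.
apply: measurable_tuple => k; case: (k \in N j) => //; exact: measurable_tnth.
Qed.

(** [decouple3] with dependence [2 * b]; the copy [DZt] is the independent third variable. *)
Lemma decouple_excl j (M : R) (h : XM * (n.-tuple XM * n.-tuple XM) -> R) :
  measurable_fun setT h -> 0 < M -> (forall z, `|h z| <= M) ->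
  `|\int[P]_w h (Z j w, (excl j w, DZt w))
    - \int[P]_w \int[P]_w' h (Z j w', (excl j w, DZt w))| <= 4 * M * b.
Proof.
move=> mh M0 hM; have -> : 4 * M * b = 2 * M * (2 * b) by ring.
by apply: decouple3 => //; [exact: measurable_excl|exact: dependence_excl|exact: independent_excl].
Qed.

(** The expectation over [Z i] with the training data [x] held fixed, that is, the difference of the
    two F terms in the i-th summand. *)
Definition pmean i (x : n.-tuple XM) := \int[P]_w v (Z i w, x).
Definition centered i (p : XM * n.-tuple XM) := v p - pmean i p.2.

Let bv : bmf v. Proof. by split => //; exists B. Qed.

Lemma bmf_pmean i : bmf (pmean i).
Proof. exact: (bmf_int P (mZ i) mDZ bv). Qed.

Lemma bmf_centered i : bmf (centered i).
Proof. by apply: bmfB => //; apply: (bmf_comp (bmf_pmean i)). Qed.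

Lemma bmf_vZ i x : bmf (fun w => v (Z i w, x)).
Proof.
apply: (bmf_comp bv); exact: (measurableT_comp (pair2_measurable x) (mZ i)).
Qed.

Lemma centered_bound i p : `|centered i p| <= 2 * B.
Proof.
rewrite (le_trans (ler_normB _ _))// mulr_natl mulr2n lerD//.
by apply: bmf_normr_Rintegral => //; exact: bmf_vZ.
Qed.

Lemma centered_mean0 i x : \int[P]_w centered i (Z i w, x) = 0.
Proof.
rewrite (bmf_RintegralB P (bmf_vZ i x) (bmf_cst T (pmean i x))) Rintegral_cst_prob; exact: subrr.
Qed.

(** With the mask [both i i] this is [D_i^{-i}], with [both i j] it is [D_i^{-i,-j}]. *)
Definition err i m w := centered i (Z i w, masked m w).

Lemma bmf_err i m : bmf (err i m).
Proof.
apply: (bmf_comp (bmf_centered i)); apply: measurable_fun_pair => //.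
exact: measurable_masked.
Qed.

(** The original data near [j] enter only through [Z j] in the second factor. Replacing [Z j] by an
    independent draw costs [4 * M * b] with [M = (2 * B) ^ 2], and afterwards that factor integrates
    to zero. *)
Lemma cross_term (i j : 'I_n) (m m' : pred 'I_n) : i \notin N j ->
  {in N j, forall k, m k} -> {in N j, forall k, m' k} ->
  `|\int[P]_w (err i m w * err j m' w)| <= 16 * B ^+ 2 * b.
Proof.
move=> ij mj mj'.
pose h (z : XM * (n.-tuple XM * n.-tuple XM)) :=
  centered i (tnth z.2.1 i, mix m z.2) * centered j (z.1, mix m' z.2).
have mmix m0 : measurable_fun setT (fun z : XM * (n.-tuple XM * n.-tuple XM) => mix m0 z.2).
  exact: (measurableT_comp (measurable_mix _) measurable_snd).
have bh : bmf h.
  apply: bmfM.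
    apply: (bmf_comp (bmf_centered i)); apply: measurable_fun_pair => //.
    apply: (measurableT_comp (measurable_tnth i)).
    exact: (measurableT_comp measurable_fst measurable_snd).
  by apply: (bmf_comp (bmf_centered j)); apply: measurable_fun_pair.
have hM z : `|h z| <= 4 * B ^+ 2.
  rewrite normrM (_ : 4 * _ = (2 * B) * (2 * B)); last by ring.
  by apply: ler_pM => //; exact: centered_bound.
have M0 : 0 < 4 * B ^+ 2 by rewrite mulr_gt0// exprn_gt0.
have := decouple_excl j (proj1 bh) M0 hM.
have -> : \int[P]_w \int[P]_w' h (Z j w', (excl j w, DZt w)) = 0.
  rewrite -[RHS](Rintegral_cst_prob P); apply: eq_Rintegral => w _; rewrite /h/=.
  rewrite bmf_RintegralZ ?centered_mean0 ?mulr0//.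
  apply: (bmf_comp (bmf_centered j)).
  exact: (measurableT_comp (pair2_measurable _) (mZ j)).
have -> : \int[P]_w h (Z j w, (excl j w, DZt w)) = \int[P]_w (err i m w * err j m' w).
  apply: eq_Rintegral => w _.
  rewrite /h /err -(masked_excl w mj) -(masked_excl w mj') /=.
  (* As [i] is not near [j], coordinate [i] of [excl j] is the true [Z i]. *)
  by rewrite tnth_mktuple (negbTE ij).
by rewrite subr0 (_ : 4 * (4 * _) = 16 * B ^+ 2); last by ring.
Qed.

(** Decoupling [Z i] from the masked training data turns the square into a variance given that data,
    which is at most the second moment bounded by [kappa]. *)
Lemma square_term (i : 'I_n) (m : pred 'I_n) : {in N i, forall k, m k} ->
  \int[P]_w \int[P]_w' (v (Z i w', masked m w)) ^+ 2 <= kappa ->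
  \int[P]_w (err i m w) ^+ 2 <= kappa + 16 * B ^+ 2 * b.
Proof.
move=> mi hk.
pose h (z : XM * (n.-tuple XM * n.-tuple XM)) := centered i (z.1, mix m z.2) ^+ 2.
have mmix : measurable_fun setT (fun z : XM * (n.-tuple XM * n.-tuple XM) => mix m z.2).
  exact: (measurableT_comp (measurable_mix _) measurable_snd).
have bh : bmf h.
  by apply: bmfX2; apply: (bmf_comp (bmf_centered i)); apply: measurable_fun_pair.
have hM z : `|h z| <= 4 * B ^+ 2.
  rewrite normrX (_ : 4 * _ = (2 * B) ^+ 2); last by ring.
  by apply: lerXn2r; rewrite ?nnegrE ?mulr_ge0 ?(ltW B0)//; exact: centered_bound.
have M0 : 0 < 4 * B ^+ 2 by rewrite mulr_gt0// exprn_gt0.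
have := decouple_excl i (proj1 bh) M0 hM.
have -> : \int[P]_w h (Z i w, (excl i w, DZt w)) = \int[P]_w (err i m w) ^+ 2.
  by apply: eq_Rintegral => w _; rewrite /h /err/= -!masked_excl.
have -> : \int[P]_w \int[P]_w' h (Z i w', (excl i w, DZt w)) =
    \int[P]_w \int[P]_w' centered i (Z i w', masked m w) ^+ 2.
  by apply: eq_Rintegral => w _; rewrite /h/= -!masked_excl.
rewrite (_ : 4 * (4 * _) = 16 * B ^+ 2); last by ring.
move=> /ler_normlW; rewrite lerBlDl => /le_trans; apply; rewrite lerD2r.
apply: le_trans hk; apply: bmf_le_Rintegral.
- apply: (bmf_comp (h := fun x => \int[P]_w' centered i (Z i w', x) ^+ 2)) (measurable_masked m).
  by apply: (bmf_int (h := fun p => centered i p ^+ 2) P (mZ i) mDZ); exact: bmfX2 (bmf_centered i).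
- apply: (bmf_comp (h := fun x => \int[P]_w' v (Z i w', x) ^+ 2)) (measurable_masked m).
  by apply: (bmf_int (h := fun p => v p ^+ 2) P (mZ i) mDZ); exact: bmfX2.
- by move=> w; apply: Rintegral_variance_le; exact: bmf_vZ.
Qed.

Lemma Rintegral_Zs i (phi : XM -> R) : bmf phi ->
  \int[P]_w phi (Zs i w) = \int[P]_w phi (Z i w).
Proof.
move=> bphi; have bt : bmf (fun x : n.-tuple XM => phi (tnth x i)).
  by apply: (bmf_comp bphi); exact: measurable_tnth.
have H (Y : 'I_n -> T -> XM) (mY : measurable_fun setT (dataset Y)) :
    \int[P]_w phi (Y i w) = \int[law P mY]_x phi (tnth x i).
  by rewrite Rintegral_law//; apply: eq_Rintegral => w _; rewrite tnth_mktuple.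
rewrite (H _ mDZs) (H _ mDZ); congr fine; apply: eq_measure_integral => A mA _.
by rewrite /= -[LHS]/(P (DZs @^-1` A)) -law_s.
Qed.

(** [Zs i] is independent of the data and has the law of [Z i], so the premise is an average over
    the data of an inner second moment, which dominates the squared difference of the inner
    means. *)
Lemma pmean_stable i m :
  \int[P]_w (v (Zs i w, DZ w) - v (Zs i w, masked m w)) ^+ 2 <= delta ->
  \int[P]_w (pmean i (DZ w) - pmean i (masked m w)) ^+ 2 <= delta.
Proof.
apply: le_trans.
pose h (z : XM * (n.-tuple XM * n.-tuple XM)) := (v (z.1, z.2.1) - v (z.1, mix m z.2)) ^+ 2.
have mmix : measurable_fun setT (fun z : XM * (n.-tuple XM * n.-tuple XM) => mix m z.2).
  exact: (measurableT_comp (measurable_mix _) measurable_snd).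
have bh : bmf h.
  apply: bmfX2; apply: bmfB; apply: (bmf_comp bv); apply: measurable_fun_pair => //.
  exact: (measurableT_comp measurable_fst measurable_snd).
have mDD : measurable_fun setT (fun w => (DZ w, DZt w)) by exact: measurable_fun_pair.
have -> := decouple_indep (mZs i) mDD (independent_Zs i) bh.
have bp m0 : bmf (fun w => pmean i (masked m0 w)).
  by apply: (bmf_comp (bmf_pmean i)); exact: measurable_masked.
have bp0 : bmf (fun w => pmean i (DZ w)) by exact: (bmf_comp (bmf_pmean i)).
apply: bmf_le_Rintegral; first by apply: bmfX2; exact: bmfB.
  apply: (bmf_comp (h := fun x => \int[P]_w' h (Zs i w', x)) (phi := fun w => (DZ w, DZt w))) => //.
  exact: (bmf_int P (mZs i) mDD).
move=> w; rewrite (Rintegral_Zs i (phi := fun z => h (z, (DZ w, DZt w)))); last first.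
  exact: (bmf_comp bh (pair2_measurable _)).
rewrite /pmean -bmf_RintegralB; [|exact: bmf_vZ|exact: bmf_vZ].
by apply: sqr_Rintegral_le; apply: bmfB; exact: bmf_vZ.
Qed.


Definition both i j : pred 'I_n := fun k => (k \in N i) || (k \in N j).

Hypothesis stable : forall i j,
  \int[P]_w (v (Z i w, DZ w) - v (Z i w, masked (both i j) w)) ^+ 2 <= delta.
Hypothesis stable_s : forall i j,
  \int[P]_w (v (Zs i w, DZ w) - v (Zs i w, masked (both i j) w)) ^+ 2 <= delta.
Hypothesis consistent : forall i,
  \int[P]_w \int[P]_w' (v (Z i w', masked (both i i) w)) ^+ 2 <= kappa.

Definition full_err i w := centered i (Z i w, DZ w).

Lemma bmf_full_err i : bmf (full_err i).
Proof. by apply: (bmf_comp (bmf_centered i)); exact: measurable_fun_pair. Qed.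

Lemma Rintegral_sqrB_le f g (a c : R) : bmf f -> bmf g ->
  \int[P]_w (f w) ^+ 2 <= a -> \int[P]_w (g w) ^+ 2 <= c ->
  \int[P]_w (f w - g w) ^+ 2 <= 2 * a + 2 * c.
Proof.
move=> bf bg fa gc; have bf2 := bmfX2 bf; have bg2 := bmfX2 bg.
have b2 : bmf (fun _ : T => 2 : R) by exact: bmf_cst.
have bf22 := bmfM b2 bf2; have bg22 := bmfM b2 bg2.
apply: (@le_trans _ _ (\int[P]_w (2 * f w ^+ 2 + 2 * g w ^+ 2))).
  apply: bmf_le_Rintegral; [by apply: bmfX2; exact: bmfB|exact: bmfD|move=> w].
  rewrite -subr_ge0 (_ : _ - _ = (f w + g w) ^+ 2) ?sqr_ge0//; ring.
by rewrite (bmf_RintegralD P bf22 bg22) !bmf_RintegralZ// lerD// ler_pM2l.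
Qed.

(** The change splits into that of [v] and that of [pmean], each at most [delta] in mean square; the
    square of a difference is at most twice the sum of squares. *)
Lemma err_stable i j :
  \int[P]_w (full_err i w - err i (both i j) w) ^+ 2 <= 4 * delta.
Proof.
pose f w := v (Z i w, DZ w) - v (Z i w, masked (both i j) w).
pose g w := pmean i (DZ w) - pmean i (masked (both i j) w).
have mm := measurable_masked (both i j).
have bf : bmf f.
  by apply: bmfB; apply: (bmf_comp bv); exact: measurable_fun_pair.
have bg : bmf g.
  by apply: bmfB; apply: (bmf_comp (bmf_pmean i)).
have := Rintegral_sqrB_le bf bg (stable i j) (pmean_stable (stable_s i j)).
rewrite -mulrDl (_ : 2 + 2 = 4 :> R); last by ring.
apply: le_trans; rewrite le_eqVlt; apply/orP; left; apply/eqP.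
by apply: eq_Rintegral => w _; congr (_ ^+ 2); rewrite /full_err /err /centered/= /f /g; ring.
Qed.

(** Pass through [full_err], which is close to both. *)
Lemma err_stable2 i j :
  \int[P]_w (err i (both i i) w - err i (both i j) w) ^+ 2 <= 16 * delta.
Proof.
have be j' : bmf (fun w => full_err i w - err i (both i j') w).
  by apply: bmfB; [exact: bmf_full_err|exact: bmf_err].
have := Rintegral_sqrB_le (be j) (be i) (err_stable i j) (err_stable i i).
rewrite -mulrDl (_ : (2 + 2) * (4 * delta) = 16 * delta); last by ring.
apply: le_trans; rewrite le_eqVlt; apply/orP; left; apply/eqP.
by apply: eq_Rintegral => w _; congr (_ ^+ 2); ring.
Qed.

Lemma Rintegral_mul_le f g (a : R) : bmf f -> bmf g ->
  \int[P]_w (f w) ^+ 2 <= a -> \int[P]_w (g w) ^+ 2 <= a ->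
  \int[P]_w (f w * g w) <= a.
Proof.
move=> bf bg fa ga; have bf2 := bmfX2 bf; have bg2 := bmfX2 bg.
have bh : bmf (fun _ : T => 2^-1 : R) by exact: bmf_cst.
have bs := bmfD bf2 bg2.
apply: (@le_trans _ _ (\int[P]_w (2^-1 * (f w ^+ 2 + g w ^+ 2)))).
  apply: bmf_le_Rintegral; [exact: bmfM|exact: bmfM|move=> w].
  rewrite ler_pdivlMl// -subr_ge0 (_ : _ - _ = (f w - g w) ^+ 2) ?sqr_ge0//; ring.
by rewrite bmf_RintegralZ// (bmf_RintegralD P bf2 bg2) ler_pdivrMl// mulr_natl mulr2n lerD.
Qed.

Let inN i j : (j \in N i) = (rho i j <= r). Proof. by rewrite inE. Qed.

Let sub_l i j : {in N i, forall k, both i j k}.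
Proof. by move=> k kN; rewrite /both kN. Qed.

Let sub_r i j : {in N j, forall k, both i j k}.
Proof. by move=> k kN; rewrite /both kN orbT. Qed.

Lemma delta_ge0 (i : 'I_n) : 0 <= delta.
Proof. by apply: le_trans (stable i i); apply: Rintegral_nneg => w; exact: sqr_ge0. Qed.

Lemma near_pair i j : \int[P]_w (err i (both i i) w * err j (both j j) w) <=
  kappa + 16 * B ^+ 2 * b.
Proof.
by apply: Rintegral_mul_le; [exact: bmf_err|exact: bmf_err| |];
  apply: square_term => //; exact: sub_l.
Qed.

(* With x' = err i (both i j) and y' = err j (both i j),
   x y = (x - x') (y - y') + x' y + x y' - x' y': the first product is second
   order in the stability, and in each other one the data near one of the two
   indices enters a single factor, which is centered given the rest. *)
Lemma far_pair i j : j \notin N i ->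
  \int[P]_w (err i (both i i) w * err j (both j j) w) <=
  16 * delta + 48 * B ^+ 2 * b.
Proof.
move=> ji; have ij : i \notin N j by move: ji; rewrite !inN rho_sym.
have bothC : both i j = both j i by apply/funext => k; rewrite /both orbC.
pose x := err i (both i i); pose y := err j (both j j).
pose x' := err i (both i j); pose y' := err j (both i j).
have bx : bmf x by exact: bmf_err.
have by_ : bmf y by exact: bmf_err.
have bx' : bmf x' by exact: bmf_err.
have by' : bmf y' by exact: bmf_err.
have h1 : \int[P]_w ((x w - x' w) * (y w - y' w)) <= 16 * delta.
  apply: Rintegral_mul_le; [exact: bmfB|exact: bmfB|exact: err_stable2|].
  rewrite /y' bothC; exact: err_stable2.
have h2 : `|\int[P]_w (x' w * y w)| <= 16 * B ^+ 2 * b.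
  by apply: cross_term => //; first [exact: sub_l|exact: sub_r].
(* The roles of [i] and [j] are exchanged: here [Z i] is decoupled, with [x] as the centered
   factor. *)
have h3 : `|\int[P]_w (y' w * x w)| <= 16 * B ^+ 2 * b.
  by apply: cross_term => //; first [exact: sub_l|exact: sub_r].
have h4 : `|\int[P]_w (x' w * y' w)| <= 16 * B ^+ 2 * b.
  by apply: cross_term => //; first [exact: sub_l|exact: sub_r].
have b1 := bmfM (bmfB bx bx') (bmfB by_ by'); have b2 := bmfM bx' by_.
have b3 := bmfM by' bx; have b4 := bmfM bx' by'.
have -> : \int[P]_w (x w * y w) = \int[P]_w ((x w - x' w) * (y w - y' w))
    + \int[P]_w (x' w * y w) + \int[P]_w (y' w * x w) - \int[P]_w (x' w * y' w).
  rewrite -(bmf_RintegralD P b1 b2) -(bmf_RintegralD P (bmfD b1 b2) b3).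
  rewrite -(bmf_RintegralB P (bmfD (bmfD b1 b2) b3) b4).
  by apply: eq_Rintegral => w _; ring.
rewrite (_ : 48 * B ^+ 2 * b = 3 * (16 * B ^+ 2 * b)); last by ring.
exact: (sum4_le h1 (ler_normlW h2) (ler_normlW h3) (lerNnormlW h4)).
Qed.

(** The sum splits into [A], with each neighborhood resampled, and a stability error. Then 40 is
    [2 * (16 + 4)] and 128 is [2 * (48 + 16)], from far pairs, the stability error and near
    pairs. *)
Lemma second_moment : \int[P]_w (\sum_i full_err i w) ^+ 2 <=
  n%:R * (40 * (n%:R * delta) + 128 * B ^+ 2 * (n%:R * b) + 2 * (Nbar rho r * kappa)).
Proof.
(* Nonnegativity of [delta] and [kappa] is read off at some index, so [n = 0] is separate. *)
case: (posnP n) => [n0|n_gt0].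
  have I0 (i : 'I_n) : False by have := ltn_ord i; rewrite {2}n0.
  have -> : \int[P]_w (\sum_i full_err i w) ^+ 2 = \int[P]_w (0 : R).
    apply: eq_Rintegral => w _; rewrite big1 ?expr0n// => i _; by case: (I0 i).
  by rewrite Rintegral_cst_prob (_ : n%:R = 0 :> R) ?mul0r// n0.
pose i0 := Ordinal n_gt0.
have d0 := delta_ge0 i0.
pose a i := err i (both i i); pose e i w := full_err i w - a i w.
have ba i : bmf (a i) by exact: bmf_err.
have be i : bmf (e i) by apply: bmfB => //; exact: bmf_full_err.
pose A w := \sum_i a i w; pose Er w := \sum_i - e i w.
have bA : bmf A by exact: bmf_sum.
have bEr : bmf Er by apply: bmf_sum => i; exact: bmfN.
have k0 : 0 <= kappa.
  by apply: le_trans (consistent i0); apply: Rintegral_nneg => w; apply: Rintegral_nneg => w'; exact: sqr_ge0.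
have Bb0 c : 0 <= c -> 0 <= c * B ^+ 2 * b 
  by move=> c0; apply: mulr_ge0 => //; apply: mulr_ge0 => //; exact: sqr_ge0.
have hA : \int[P]_w A w ^+ 2 <= n%:R * (n%:R * (16 * delta + 48 * B ^+ 2 * b)
    + Nbar rho r * (kappa + 16 * B ^+ 2 * b)).
  have -> : \int[P]_w A w ^+ 2 = \sum_i \sum_j \int[P]_w (a i w * a j w).
    have bm i j : bmf (fun w => a i w * a j w) by exact: bmfM.
    under [RHS]eq_bigr => i _.
      rewrite -(bmf_Rintegral_sum P (index_enum 'I_n) xpredT (fun j => bm i j)); over.
    rewrite -(bmf_Rintegral_sum P (index_enum 'I_n) xpredT
      (F := fun i w => \sum_j a i w * a j w)); last first.
      by move=> i; exact: bmf_sum.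
    by apply: eq_Rintegral => w _; rewrite expr2 big_distrlr.
  (* One bound for all pairs: the far bound plus, for neighbors only, the near bound. Summing the
     indicator produces [Nbar]. *)
  have pair i j : \int[P]_w (a i w * a j w) <=
      (16 * delta + 48 * B ^+ 2 * b) + (j \in N i)%:R * (kappa + 16 * B ^+ 2 * b).
    have [jN|jN] := boolP (j \in N i).
      rewrite mul1r; apply: le_trans (near_pair i j) _; rewrite lerDr.
      by rewrite addr_ge0 ?Bb0// mulr_ge0.
    by rewrite mul0r addr0; exact: far_pair.
  have -> : n%:R * (n%:R * (16 * delta + 48 * B ^+ 2 * b)
    + Nbar rho r * (kappa + 16 * B ^+ 2 * b)) =
    \sum_i \sum_j ((16 * delta + 48 * B ^+ 2 * b) + (j \in N i)%:R * (kappa + 16 * B ^+ 2 * b)).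
    have inner i : \sum_j ((16 * delta + 48 * B ^+ 2 * b)
        + (j \in N i)%:R * (kappa + 16 * B ^+ 2 * b)) =
        n%:R * (16 * delta + 48 * B ^+ 2 * b)
        + #|nbhd rho i r|%:R * (kappa + 16 * B ^+ 2 * b).
      rewrite big_split/= -mulr_suml sumr_const card_ord [n%:R * _]mulr_natl; congr (_ + _ * _).
      rewrite -natr_sum -sum1_card [in RHS]big_mkcond/=; congr (_%:R).
    rewrite [RHS](eq_bigr _ (fun i _ => inner i)) big_split/= sumr_const card_ord -mulr_suml.
    have nN : n%:R * Nbar rho r = \sum_(i < n) #|nbhd rho i r|%:R.
      by rewrite /Nbar mulrA mulfV ?mul1r// pnatr_eq0 -lt0n.
    by rewrite mulrDr [n%:R * (Nbar _ _ * _)]mulrA nN [n%:R * (n%:R * _)]mulr_natl.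
  by apply: ler_sum => i _; apply: ler_sum => j _; exact: pair.
have hE : \int[P]_w Er w ^+ 2 <= n%:R * (n%:R * (4 * delta)).
  apply: (@le_trans _ _ (\int[P]_w (n%:R * \sum_i e i w ^+ 2))).
    apply: bmf_le_Rintegral; [exact: bmfX2|apply: bmfM; [exact: bmf_cst|]|].
      by apply: bmf_sum => i; exact: bmfX2.
    move=> w; apply: le_trans (sqr_sum_le _) _; rewrite ler_wpM2l//.
    by apply: ler_sum => i _; rewrite sqrrN.
  have be2 i : bmf (fun w => e i w ^+ 2) by exact: bmfX2.
  rewrite bmf_RintegralZ; last exact: bmf_sum.
  rewrite ler_wpM2l// bmf_Rintegral_sum//; apply: (@le_trans _ _ (\sum_(i < n) 4 * delta)).
    by apply: ler_sum => i _; exact: err_stable.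
  by rewrite sumr_const card_ord [n%:R * _]mulr_natl.
(* Absorbs the beta error of the near pairs into the term in [n * b]. *)
have NN : Nbar rho r <= n%:R.
  rewrite /Nbar ler_pdivrMl ?ltr0n//.
  apply: (@le_trans _ _ (\sum_(i < n) n%:R)); last first.
    by rewrite sumr_const card_ord [n%:R * _]mulr_natl.
  by apply: ler_sum => i _; rewrite ler_nat -[leqRHS]card_ord max_card.
have -> : \int[P]_w (\sum_i full_err i w) ^+ 2 = \int[P]_w (A w - Er w) ^+ 2.
  apply: eq_Rintegral => w _; congr (_ ^+ 2); rewrite /A /Er -sumrB.
  by apply: eq_bigr => i _; rewrite /e; ring.
apply: le_trans (Rintegral_sqrB_le bA bEr hA hE) _.
have H : Nbar rho r * (16 * B ^+ 2 * b) <= n%:R * (16 * B ^+ 2 * b).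
  by rewrite ler_wpM2r// Bb0.
move: H; move: (Nbar rho r) => N0; move: (n%:R : R) (ler0n R n) => m m0 H.
rewrite -subr_ge0 (_ : _ - _ = 2 * m * (m * (16 * B ^+ 2 * b) - N0 * (16 * B ^+ 2 * b))).
  by apply: mulr_ge0; rewrite ?mulr_ge0// subr_ge0.
ring.
Qed.

End finite_sample.

(** * Passage to the limit *)

Lemma cvge0_near_le {R : realType} (u : nat -> \bar R) : u @ \oo --> 0%E ->
  forall e : R, 0 < e -> \forall n \near \oo, (u n <= e%:E)%E.
Proof.
move=> /fine_cvgP[fu cu] e e0; near=> n.
have fn : u n \is a fin_num by near: n.
rewrite -(fineK fn) lee_fin ltW//; near: n; exact: (cvgr_lt _ cu).
Unshelve. all: by end_near. Qed.

Lemma near_le_cvge0 {R : realType} (u : nat -> \bar R) : (forall n, 0 <= u n)%E ->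
  (forall e : R, 0 < e -> \forall n \near \oo, (u n <= e%:E)%E) -> u @ \oo --> 0%E.
Proof.
move=> u0 H; apply/fine_cvgP; split.
  near=> n; rewrite ge0_fin_numE//; apply: le_lt_trans (ltry 1).
  by near: n; exact: H.
apply/cvgr0Pnorm_le => e e0; near=> n.
have un : (u n <= e%:E)%E by near: n; exact: H.
have fn : u n \is a fin_num by rewrite ge0_fin_numE// (le_lt_trans un)// ltry.
by rewrite /= ger0_norm ?fine_ge0// -lee_fin fineK.
Unshelve. all: by end_near. Qed.

Lemma Ex_bmf {R : realType} d (T : measurableType d) (P : probability T R) (X : T -> R) :
  bmf X -> Ex P X = (\int[P]_w X w)%:E.
Proof.
move=> bX; rewrite /Ex /Rintegral fineK//.
by apply: integrable_fin_num => //; exact: bmf_integrable.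
Qed.

(** Chebyshev: [eps ^+ 2] times the indicator of the event is at most the square of [X]. *)
Lemma second_moment_tail {R : realType} d (T : measurableType d) (P : probability T R)
  (X : T -> R) (eps : R) : bmf X -> 0 < eps ->
  (P [set w | eps < `|X w|]%R <= (eps ^- 2 * \int[P]_w X w ^+ 2)%:E)%E.
Proof.
move=> bX e0; set A := [set w | _].
have mA : measurable A.
  rewrite -[A]setTI; have -> : A = (fun w => `|X w|) @^-1` `]eps, +oo[%classic.
    by apply/seteqP; split => w /=; rewrite in_itv/= andbT.
  have mX : measurable_fun setT (fun w => `|X w|).
    by apply: measurableT_comp => //; case: bX.
  exact: mX.
have e20 : 0 < eps ^+ 2 by rewrite exprn_gt0.
rewrite -[leLHS]fineK ?fin_num_measure// lee_fin -Rintegral_indic_prob// ler_pdivlMl//.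
have bA : bmf (\1_A : T -> R).
  split; first exact: measurable_indic.
  by exists 1 => x; rewrite indicE; case: (_ \in _); rewrite /= ?normr1 ?normr0.
rewrite -bmf_RintegralZ//; apply: bmf_le_Rintegral; [apply: bmfM => //; exact: bmf_cst|exact: bmfX2|move=> w].
rewrite indicE; case: (boolP (w \in A)) => [/set_mem wA|_] /=.
  rewrite mulr1 -[leRHS]real_normK ?num_real//.
  by apply: lerXn2r; rewrite ?nnegrE ?(ltW e0)//; exact: ltW.
by rewrite mulr0 sqr_ge0.
Qed.

Lemma root_scaled_le {R : realType} (m I z : R) : 0 < m -> 0 <= I -> 0 <= z ->
  ((Num.sqrt m)%:E * (I%:E `^ 2^-1) <= (Num.sqrt z)%:E)%E -> I <= m^-1 * z.
Proof.
move=> m0 I0 z0; rewrite poweR_EFin powR12_sqrt// -EFinM lee_fin.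
by rewrite -(sqrtrM I (ltW m0)) ler_sqrt// ler_pdivlMl.
Qed.

(** * From the conditions on the learner to a tail bound at one sample size *)

Section one_sample_size.
Context {R : realType} d (T : measurableType d) (P : probability T R).
Context dX (XM : measurableType dX) (n dg : nat) (Z Zt Zs : 'I_n -> T -> XM).
Local Notation Gam := (XM -> 'rV[R]_dg).
Variables (rho : 'I_n -> 'I_n -> R) (r : R) (f : XM -> Gam -> R)
  (learn : n.-tuple XM -> Gam) (g0 : Gam) (G : set Gam) (Zset : set XM).
Variables (C L q zeta : R) (pt : XM).
Hypothesis n_gt0 : (0 < n)%N.
Hypothesis rho_sym : forall i j, rho i j = rho j i.
Hypothesis rho_self : forall i, rho i i <= r.
Hypothesis mZ : forall i, measurable_fun setT (Z i).
Hypothesis mZt : forall i, measurable_fun setT (Zt i).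
Hypothesis mZs : forall i, measurable_fun setT (Zs i).
Hypothesis ZZ : forall i w, Zset (Z i w).
Hypothesis ZZs : forall i w, Zset (Zs i w).
Hypothesis law_s : same_law P (dataset Z) (dataset Zs).
Hypothesis ind : indep3 P (sigmaS Z [set: 'I_n]%SET) (sigmaS Zt [set: 'I_n]%SET)
  (sigmaS Zs [set: 'I_n]%SET).
Hypothesis Gg0 : G g0.
Hypothesis Glearn : forall x, G (learn x).
Hypothesis mf : forall g, G g -> measurable_fun setT (fun z => f z g).
Hypothesis mg : forall g c, G g -> measurable_fun setT (fun z => g z 0 c).
Hypothesis mfl : measurable_fun setT (fun x : XM * n.-tuple XM => f x.1 (learn x.2)).
Hypothesis ml : forall c,
  measurable_fun setT (fun x : XM * n.-tuple XM => learn x.2 x.1 0 c).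
Hypothesis fC : forall z g, Zset z -> G g -> `|f z g| <= C.
Hypothesis L0 : 0 < L.
Hypothesis lip : forall g g' i, G g -> G g' ->
  (Ex P (fun w => ((f (Z i w) g - f (Z i w) g') ^+ 2)%R)
    <= L%:E * (norm2i P (Z i) (fun z => (g z - g' z)%R)) `^ q)%E.
Hypothesis zeta0 : 0 < zeta.
Hypothesis stable : ((Num.sqrt n%:R)%:E *
   maxe
    (\big[maxe/0%E]_(i < n) \big[maxe/0%E]_(j < n)
      (Ex P (fun w =>
         ((f (Z i w) (learn (dataset Z w))
          - f (Z i w) (learn (dataset_repl Z Zt rho r i j w))) ^+ 2)%R)
      `^ (2^-1)%R))
    (\big[maxe/0%E]_(i < n) \big[maxe/0%E]_(j < n)
      (Ex P (fun w =>
         ((f (Zs i w) (learn (dataset Z w))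
          - f (Zs i w) (learn (dataset_repl Z Zt rho r i j w))) ^+ 2)%R)
      `^ (2^-1)%R)) <= (Num.sqrt zeta)%:E)%E.
Hypothesis consistent : ((Nbar rho r)%:E *
     \big[maxe/0%E]_(i < n)
       \int[P]_w ((norm2i P (Z i)
          (fun z => (learn (dataset_repl Z Zt rho r i i w) z - g0 z)%R))
          `^ q) <= zeta%:E)%E.
Hypothesis beta_small : (n%:R%:E * beta_n P Z rho r <= zeta%:E)%E.

Let C' := `|C| + 1.

Let C'0 : 0 < C'. Proof. by rewrite /C' ltr_pwDr. Qed.

(* [f] is only bounded on [Zset], which need not be measurable. *)
Definition trunc (y : R) := Num.max (- C') (Num.min C' y).

Lemma trunc_id z g : Zset z -> G g -> trunc (f z g) = f z g.
Proof.
move=> Zz Gg; have : `|f z g| <= C'.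
  by rewrite (le_trans (fC Zz Gg))// (le_trans (ler_norm _))// /C' lerDl.
rewrite ler_norml /trunc => /andP[h1 h2].
by rewrite (min_idPr h2) (max_idPr h1).
Qed.

Lemma trunc_bound y : `|trunc y| <= C'.
Proof.
have C0 := ltW C'0.
by rewrite ler_norml /trunc le_max lexx/= ge_max ge_min lexx (le_trans _ C0)// oppr_le0.
Qed.

Lemma measurable_trunc d' (S : measurableType d') (h : S -> R) :
  measurable_fun setT h -> measurable_fun setT (fun x => trunc (h x)).
Proof.
by move=> mh; apply: measurable_maxr => //; exact: measurable_minr.
Qed.

Let v (p : XM * n.-tuple XM) := trunc (f p.1 (learn p.2)) - trunc (f p.1 g0).

Let vE z x : Zset z -> v (z, x) = f z (learn x) - f z g0.
Proof. by move=> Zz; rewrite /v/= !trunc_id. Qed.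

Let mv : measurable_fun setT v.
Proof.
apply: measurable_funB; apply: measurable_trunc => //.
exact: (measurableT_comp (mf Gg0) measurable_fst).
Qed.

Let vB p : `|v p| <= 2 * C'.
Proof. by rewrite (le_trans (ler_normB _ _))// mulr_natl mulr2n lerD// trunc_bound. Qed.

Let bv : bmf v. Proof. by split=> //; exists (2 * C'). Qed.

Let n0 : 0 < n%:R :> R. Proof. by rewrite ltr0n. Qed.

Let mmask m : measurable_fun setT (masked Z Zt m).
Proof. exact: measurable_masked. Qed.

Let mD : measurable_fun setT (dataset Z). Proof. exact: measurable_tuple. Qed.

(** [Y] is [Z] or [Zs], so one argument serves both maxima. The [g0] terms cancel in the difference
    of the two values of [v]. *)
Lemma stable_case (Y : 'I_n -> T -> XM) i j : (forall i, measurable_fun setT (Y i)) ->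
  (forall i w, Zset (Y i w)) ->
  ((Num.sqrt n%:R)%:E *
      \big[maxe/0%E]_(i < n) \big[maxe/0%E]_(j < n)
      (Ex P (fun w =>
         ((f (Y i w) (learn (dataset Z w))
          - f (Y i w) (learn (dataset_repl Z Zt rho r i j w))) ^+ 2)%R)
      `^ (2^-1)%R) <= (Num.sqrt zeta)%:E)%E ->
  \int[P]_w (v (Y i w, dataset Z w) - v (Y i w, masked Z Zt (both rho r i j) w)) ^+ 2
    <= n%:R^-1 * zeta.
Proof.
move=> mY ZY H.
have bI : bmf (fun w => (v (Y i w, dataset Z w) - v (Y i w, masked Z Zt (both rho r i j) w)) ^+ 2).
  by apply: bmfX2; apply: bmfB; apply: (bmf_comp bv); exact: measurable_fun_pair.
apply: root_scaled_le; [by []|by apply: Rintegral_nneg => w; exact: sqr_ge0|exact: ltW|].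
apply: le_trans H; apply: lee_wpmul2l; first by rewrite lee_fin sqrtr_ge0.
rewrite -Ex_bmf//.
have -> : (fun w => (v (Y i w, dataset Z w) - v (Y i w, masked Z Zt (both rho r i j) w)) ^+ 2)
  = (fun w => ((f (Y i w) (learn (dataset Z w))
          - f (Y i w) (learn (dataset_repl Z Zt rho r i j w))) ^+ 2)).
  apply/funext => w; rewrite !vE//; congr (_ ^+ 2).
  by rewrite dataset_repl_masked opprB addrA subrK.
apply: le_trans (le_bigmax _ _ i).
exact: (le_bigmax _ _ j).
Qed.

(** The Lipschitz-type condition holds for each frozen training set; integrating it over the
    training data gives the consistency error. *)
Lemma consistent_case i :
  \int[P]_w \int[P]_w' (v (Z i w', masked Z Zt (both rho r i i) w)) ^+ 2
    <= (Nbar rho r)^-1 * (L * zeta).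
Proof.
have Nb0 : 0 < Nbar rho r.
  rewrite mulr_gt0 ?invr_gt0//; apply: (@lt_le_trans _ _ (\sum_(i < n) 1)).
    by rewrite sumr_const card_ord.
  apply: ler_sum => j _; rewrite ler1n card_gt0; apply/set0Pn; exists j.
  by rewrite inE rho_self.
have bI : bmf (fun w => \int[P]_w' (v (Z i w', masked Z Zt (both rho r i i) w)) ^+ 2).
  apply: (bmf_comp (h := fun x => \int[P]_w' v (Z i w', x) ^+ 2)) (mmask _).
  by apply: (bmf_int (h := fun p => v p ^+ 2) P (mZ i) mD); exact: bmfX2.
have [phi phiE] : exists phi : T -> \bar R, phi = (fun w => ((norm2i P (Z i)
          (fun z => (learn (dataset_repl Z Zt rho r i i w) z - g0 z)%R)) `^ q)%E).
  by eexists.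
have phi0 w : (0 <= phi w)%E by rewrite phiE; exact: poweR_ge0.
have mphi : measurable_fun setT phi.
  rewrite phiE.
  apply: (measurableT_comp (measurable_poweR q)).
  apply: (measurableT_comp (measurable_poweR 2^-1)).
  (* The first coordinate draws the evaluation point, the second the training data. Tonelli makes
     the squared norm measurable in the latter. *)
  pose h (p : T * T) : \bar R :=
    (sqnorm (learn (masked Z Zt (both rho r i i) p.2) (Z i p.1) - g0 (Z i p.1)))%:E.
  have -> : (fun w => Ex P (fun w0 => sqnorm
       (learn (dataset_repl Z Zt rho r i i w) (Z i w0) - g0 (Z i w0)))) = fubini_G P h.
    apply/funext => w; rewrite /fubini_G /Ex; apply: eq_integral => w' _.
    by rewrite /h /= dataset_repl_masked.
  apply: measurable_fun_fubini_tonelli_G; last first.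
    by move=> p; rewrite lee_fin sumr_ge0// => c _; exact: sqr_ge0.
  apply/measurable_EFinP; apply: measurable_sum => c; apply: measurable_funX.
  have m1 : measurable_fun setT (fun p : T * T => Z i p.1) by exact: (measurableT_comp (mZ i) measurable_fst).
  have m2 : measurable_fun setT (fun p : T * T => masked Z Zt (both rho r i i) p.2).
    exact: (measurableT_comp (mmask _) measurable_snd).
  have := measurable_funB (measurableT_comp (ml c) (measurable_fun_pair m1 m2))
    (measurableT_comp (mg c Gg0) m1).
  by congr (measurable_fun _ _); apply/funext => p /=; rewrite !mxE.
have Hphi : (\int[P]_w phi w <= ((Nbar rho r)^-1 * zeta)%:E)%E.
  rewrite EFinM lee_pdivlMl//; apply: le_trans consistent.
  apply: lee_wpmul2l; first by rewrite lee_fin ltW.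
  by rewrite phiE; exact: (le_bigmax _ _ i).
have le_phi w : ((\int[P]_w' (v (Z i w', masked Z Zt (both rho r i i) w)) ^+ 2)%R%:E
    <= L%:E * phi w)%E.
  have b2 : bmf (fun w' => v (Z i w', masked Z Zt (both rho r i i) w) ^+ 2).
    apply: bmfX2; apply: (bmf_comp bv).
    exact: (measurableT_comp (pair2_measurable _) (mZ i)).
  rewrite -(Ex_bmf P b2).
  have -> : (fun w' => v (Z i w', masked Z Zt (both rho r i i) w) ^+ 2) =
    (fun w' => (f (Z i w') (learn (dataset_repl Z Zt rho r i i w)) - f (Z i w') g0) ^+ 2).
    by apply/funext => w'; rewrite vE// dataset_repl_masked.
  by rewrite phiE; exact: (lip i (Glearn _) Gg0).
have mI : measurable_fun setT
    (fun w => (\int[P]_w' (v (Z i w', masked Z Zt (both rho r i i) w)) ^+ 2)%:E).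
  by apply/measurable_EFinP; case: bI.
have mLphi : measurable_fun setT (fun w => (L%:E * phi w)%E).
  exact: emeasurable_funM.
have I0 w : setT w ->
    (0 <= (\int[P]_w' (v (Z i w', masked Z Zt (both rho r i i) w)) ^+ 2)%R%:E)%E.
  by move=> _; rewrite lee_fin; apply: Rintegral_nneg => w'; exact: sqr_ge0.
have := ge0_le_integral P measurableT I0 mI mLphi (fun w _ => le_phi w).
rewrite (ge0_integralZl_EFin P measurableT (fun w _ => phi0 w) mphi (ltW L0)).
have L0' : (0 <= L%:E)%E by rewrite lee_fin ltW.
move=> /le_trans /(_ (lee_wpmul2l L0' Hphi)).
rewrite -[leLHS]/(Ex P (fun w => \int[P]_w' (v (Z i w', masked Z Zt (both rho r i i) w)) ^+ 2)).
rewrite (Ex_bmf P bI) -EFinM lee_fin => H.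
by rewrite (mulrCA _ L).
Qed.

Lemma full_errE i w : full_err P Z v i w =
  (f (Z i w) (learn (dataset Z w)) - f (Z i w) g0)
   - (Fexp P (Z i) f (learn (dataset Z w)) - Fexp P (Z i) f g0).
Proof.
have bf g : G g -> bmf (fun w' => f (Z i w') g).
  move=> Gg; split; last by exists C => w'; exact: fC.
  exact: measurableT_comp (mf Gg) (mZ i).
rewrite /full_err /centered /= vE//; congr (_ - _).
rewrite /Fexp -[fine (Ex _ _)]/(\int[P]_w' f (Z i w') (learn (dataset Z w))).
rewrite -[fine (Ex _ _)]/(\int[P]_w' f (Z i w') g0).
rewrite -(bmf_RintegralB P (bf _ (Glearn _)) (bf _ Gg0)).
by apply: eq_Rintegral => w' _; rewrite vE.
Qed.

(** Chebyshev combined with [second_moment], taking [b] and [delta] to be [zeta / n], [kappa] to be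
    [L * zeta / Nbar] and [B] to be [2 * C']. *)
Lemma deviation_bound (eps : R) : 0 < eps ->
  (P [set w | (eps < Num.sqrt n%:R *
       Num.norm (n%:R^-1 * \sum_(i < n)
           ((f (Z i w) (learn (dataset Z w)) - f (Z i w) g0)
            - (Fexp P (Z i) f (learn (dataset Z w)) - Fexp P (Z i) f g0))))%R]
   <= (eps ^- 2 * ((40 + 128 * (2 * C') ^+ 2 + 2 * L) * zeta))%:E)%E.
Proof.
move=> e0; pose X w := Num.sqrt n%:R * (n%:R^-1 * \sum_i full_err P Z v i w).
have bS : bmf (fun w => \sum_i full_err P Z v i w).
  by apply: bmf_sum => i; exact: (bmf_full_err P mZ mv vB i).
have bX : bmf X by do 2![apply: bmfM; first exact: bmf_cst].
have -> : [set w | (eps < Num.sqrt n%:R *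
       Num.norm (n%:R^-1 * \sum_(i < n)
           ((f (Z i w) (learn (dataset Z w)) - f (Z i w) g0)
            - (Fexp P (Z i) f (learn (dataset Z w)) - Fexp P (Z i) f g0))))%R] =
    [set w | eps < `|X w|].
  apply/funext => w /=; rewrite /X (eq_bigr _ (fun i _ => full_errE i w)).
  by rewrite [in RHS]normrM (ger0_norm (sqrtr_ge0 n%:R)).
apply: le_trans (second_moment_tail P bX e0) _.
rewrite lee_fin ler_wpM2l ?invr_ge0 ?sqr_ge0//.
have -> : \int[P]_w X w ^+ 2 = n%:R^-1 * \int[P]_w (\sum_i full_err P Z v i w) ^+ 2.
  rewrite -bmf_RintegralZ; last exact: bmfX2.
  apply: eq_Rintegral => w _; rewrite /X !exprMn sqr_sqrtr ?ltW//.
  by rewrite mulrA expr2 mulrA mulfV ?gt_eqF// mul1r.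
rewrite ler_pdivrMl//.
have B0 : 0 < 2 * C' by rewrite mulr_gt0.
have b0 : 0 <= n%:R^-1 * zeta by rewrite mulr_ge0 ?invr_ge0 ?ltW.
have hb : (beta_n P Z rho r <= (n%:R^-1 * zeta)%:E)%E by rewrite EFinM lee_pdivlMl.
have sl : (0 <= (Num.sqrt n%:R : R)%:E)%E by rewrite lee_fin sqrtr_ge0.
have st : forall i j, \int[P]_w (v (Z i w, dataset Z w)
    - v (Z i w, masked Z Zt (both rho r i j) w)) ^+ 2 <= n%:R^-1 * zeta.
  move=> i j; apply: stable_case => //; apply: le_trans stable.
  by apply: lee_wpmul2l => //; rewrite le_max lexx.
have sts : forall i j, \int[P]_w (v (Zs i w, dataset Z w)
    - v (Zs i w, masked Z Zt (both rho r i j) w)) ^+ 2 <= n%:R^-1 * zeta.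
  move=> i j; apply: stable_case => //; apply: le_trans stable.
  by apply: lee_wpmul2l => //; rewrite le_max lexx orbT.
apply: le_trans (second_moment pt rho_sym mZ mZt mZs law_s ind mv B0 vB b0 hb st sts
  consistent_case) _.
(* [n] and [Nbar] cancel against their inverses; [Nbar] is positive since every index lies in its
   own neighborhood. *)
rewrite ler_pM2l// !mulVKf ?gt_eqF//; last first.
  rewrite mulr_gt0 ?invr_gt0//; apply: (@lt_le_trans _ _ (\sum_(i < n) 1)).
    by rewrite sumr_const card_ord.
  apply: ler_sum => j _; rewrite ler1n card_gt0; apply/set0Pn; exists j.
  by rewrite inE rho_self.
by rewrite [leRHS]mulrDl [X in _ <= X + _]mulrDl -[2 * L * zeta]mulrA lexx.
Qed.

End one_sample_size.

Unset Implicit Arguments. Set Strict Implicit. Set Printing Implicit Defensive.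

Theorem theorem1 (R : realType) (dz dg p : nat)
  (Zset : set (dz.-tuple R))
  (G : set (dz.-tuple R -> 'rV[R]_dg)) (g0 : dz.-tuple R -> 'rV[R]_dg)
  (psi : dz.-tuple R -> (dz.-tuple R -> 'rV[R]_dg) -> 'M[R]_p)
  (nu : dz.-tuple R -> (dz.-tuple R -> 'rV[R]_dg) -> 'cV[R]_p)
  (learner : forall n : nat, n.-tuple (dz.-tuple R) -> (dz.-tuple R -> 'rV[R]_dg))
  (rho : forall n : nat, 'I_n -> 'I_n -> R)
  (dO : nat -> measure_display) (Omega : forall n : nat, measurableType (dO n))
  (P : forall n : nat, probability (Omega n) R)
  (Z Zt Zs : forall n : nat, 'I_n -> Omega n -> dz.-tuple R)
  (r : nat -> R) (L q : R) :
  (* standing assumptions: semi-metrics *)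
  (forall n i j, 0 <= rho n i j) ->
  (forall n i j, rho n i j = rho n j i) ->
  (forall n i j, rho n i j = 0 <-> i = j) ->
  (* the data and its copies *)
  (forall n i, [/\ measurable_fun setT (Z n i), measurable_fun setT (Zt n i)
                 & measurable_fun setT (Zs n i)]) ->
  (forall n i w, [/\ Zset (Z n i w), Zset (Zt n i w) & Zset (Zs n i w)]) ->
  (forall n, same_law (P n) (dataset (Z n)) (dataset (Zt n)) /\
             same_law (P n) (dataset (Z n)) (dataset (Zs n))) ->
  (forall n, indep3 (P n) (sigmaS (Z n) [set: 'I_n]%SET) (sigmaS (Zt n) [set: 'I_n]%SET)
                    (sigmaS (Zs n) [set: 'I_n]%SET)) ->
  (* the function class, the learner and measurability *)
  G g0 ->
  (forall n x, G (learner n x)) ->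
  (forall (s : fsel) k l g, G g -> measurable_fun setT (fun z => fkl psi nu s k l z g)) ->
  (forall g c, G g -> measurable_fun setT (fun z => g z 0 c)) ->
  (forall (s : fsel) k l n, measurable_fun setT
     (fun x : dz.-tuple R * n.-tuple (dz.-tuple R) => fkl psi nu s k l x.1 (learner n x.2))) ->
  (forall n c, measurable_fun setT
     (fun x : dz.-tuple R * n.-tuple (dz.-tuple R) => learner n x.2 x.1 0 c)) ->
  (* neighborhood radii *)
  (forall n, 0 <= r n) ->
  (* (i)(a) bounded ranges *)
  (exists C : R, forall (s : fsel) k l z g, Zset z -> G g -> `|fkl psi nu s k l z g| <= C) ->
  (* (i)(b) *)
  0 < L -> 0 < q ->
  (forall (s : fsel) k l g g' n i, G g -> G g' ->
     (Ex (P n) (fun w => ((fkl psi nu s k l (Z n i w) g - fkl psi nu s k l (Z n i w) g') ^+ 2)%R)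
      <= L%:E * (norm2i (P n) (Z n i) (fun z => (g z - g' z)%R)) `^ q)%E) ->
  (* (ii) neighborhood stability *)
  (forall (s : fsel) k l,
     ((fun n : nat => (Num.sqrt n%:R)%:E *
       maxe
        (\big[maxe/0%E]_(i < n) \big[maxe/0%E]_(j < n)
          (Ex (P n) (fun w =>
             ((fkl psi nu s k l (Z n i w) (learner n (dataset (Z n) w))
              - fkl psi nu s k l (Z n i w)
                  (learner n (dataset_repl (Z n) (Zt n) (rho n) (r n) i j w))) ^+ 2)%R)
          `^ (2^-1)%R))
        (\big[maxe/0%E]_(i < n) \big[maxe/0%E]_(j < n)
          (Ex (P n) (fun w =>
             ((fkl psi nu s k l (Zs n i w) (learner n (dataset (Z n) w))
              - fkl psi nu s k l (Zs n i w)
                  (learner n (dataset_repl (Z n) (Zt n) (rho n) (r n) i j w))) ^+ 2)%R)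
          `^ (2^-1)%R)))%E
     @ \oo --> 0%E)) ->
  (* (iii) learner consistency *)
  ((fun n : nat => (Nbar (rho n) (r n))%:E *
     \big[maxe/0%E]_(i < n)
       \int[P n]_w ((norm2i (P n) (Z n i)
          (fun z => (learner n (dataset_repl (Z n) (Zt n) (rho n) (r n) i i w) z - g0 z)%R))
          `^ q))%E
   @ \oo --> 0%E) ->
  (* (iv) weak dependence *)
  ((fun n : nat => (n%:R)%:E * beta_n (P n) (Z n) (rho n) (r n))%E @ \oo --> 0%E) ->
  (* conclusion: o_p(n^{-1/2}) *)
  forall (s : fsel) k l (eps : R), 0 < eps ->
    ((fun n : nat => P n [set w | (eps < Num.sqrt n%:R *
       Num.norm (n%:R^-1 * \sum_(i < n)
           ((fkl psi nu s k l (Z n i w) (learner n (dataset (Z n) w))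
             - fkl psi nu s k l (Z n i w) g0)
            - (Fexp (P n) (Z n i) (fkl psi nu s k l) (learner n (dataset (Z n) w))
               - Fexp (P n) (Z n i) (fkl psi nu s k l) g0))))%R])%E
    @ \oo --> 0%E).
Proof.
move=> _ rhoS rhoE mZZ ZZ laws ind Gg0 Glearn mf mg mfl ml r0 [C fC] L0 _ lip stable
  consistent beta s k l eps e0.
apply: near_le_cvge0 => [n|e e'0]; first exact: measure_ge0.
pose K := 40 + 128 * (2 * (`|C| + 1)) ^+ 2 + 2 * L.
have K0 : 0 < K.
  by rewrite /K ltr_pwDr ?mulr_gt0// addr_ge0// mulr_ge0// sqr_ge0.
(* Chosen so that the bound of [deviation_bound], with [K] its constant, equals [e]. *)
pose zeta := K^-1 * (eps ^+ 2 * e).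
have zeta0 : 0 < zeta by rewrite !mulr_gt0 ?invr_gt0// exprn_gt0.
(* Stability is stated for L2 norms rather than their squares, hence the level [Num.sqrt zeta]. *)
have sz0 : 0 < Num.sqrt zeta by rewrite sqrtr_gt0.
near=> n.
have n_gt0 : (0 < n)%N by near: n; exact: nbhs_infty_gt.
have [law_t law_s] := laws n.
have pt : dz.-tuple R := [tuple of nseq dz 0].
have <- : eps ^- 2 * (K * zeta) = e.
  by rewrite mulVKf ?gt_eqF// mulKf// gt_eqF// exprn_gt0.
apply: (deviation_bound (G := G) (Zset := Zset) (Zs := @Zs n) (Zt := @Zt n)
  (r := r n) (q := q) pt) => //.
all: try by move=> i; have [] := mZZ n i.
all: try by move=> i w; have [] := ZZ n i w.
- by move=> i; rewrite (proj2 (rhoE n i i) erefl).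
- by move=> g; exact: mf.
- by move=> z g; exact: fC.
- by move=> g g' i; exact: lip.
- by near: n; exact: (cvge0_near_le (stable s k l) sz0).
- by near: n; exact: (cvge0_near_le consistent zeta0).
- by near: n; exact: (cvge0_near_le beta zeta0).
Unshelve. all: by end_near. Qed.
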